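(* Let $X_1,X_2,\ldots$ be a sequence of i.i.d. lattice random variables with finite variance $\sigma^2$ and maximal span $h>0$, and let $S_n=X_1+\cdots+X_n$, $n\ge 1$, be their partial sums. Then $$\lim_{n\to\infty}\Big[H(S_n)-\log\frac{\sqrt{n}}{h}\Big]=\frac12\log(2\pi e\sigma^2).$$
   Context: Throughout, $\log$ is the natural logarithm. For a discrete random variable $Y$ with probability mass function $p$ on a countable set $A$, its entropy is $H(Y)=-\sum_{y\in A}p(y)\log p(y)$ (with $0\log 0=0$). A real random variable $Y$ has a lattice distribution with span $h>0$ if its support is a subset of $\{a+kh: k\in\mathbb{Z}\}$ for some $a\in\mathbb{R}$; the span $h$ is maximal if it is the largest such $h$ (in particular, a random variable with a maximal span is not almost surely constant, so $\sigma^2>0$). *)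

(* Defs.v *)
From HB Require Import structures.
From mathcomp Require Import all_boot all_order all_algebra.
From mathcomp Require Import finmap.
From mathcomp Require Import all_classical all_reals all_analysis.
From mathcomp Require Import measurable_realfun.

Set Implicit Arguments.
Unset Strict Implicit.
Unset Printing Implicit Defensive.

Import Order.TTheory GRing.Theory Num.Theory.
Import numFieldNormedType.Exports.

Local Open Scope classical_set_scope.
Local Open Scope ring_scope.

Section definitions.
Context (d : measure_display) (T : measurableType d) (R : realType).
Variable P : probability T R.

(* Each term is nonnegative (0 <= pmf Y y <= 1), so the minus sign is put
   inside the sum: \esum is a supremum of finite partial sums.  The set of
   atoms of Y is countable (pmf_gt0_countable).  This is the entropy of Y only
   when Y is discrete, i.e. when its atoms carry the total mass 1. *)
Definition entropy (Y : {RV P >-> R}) : \bar R :=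
  \esum_(y in [set y | 0 < pmf Y y]) (- (pmf Y y * ln (pmf Y y)))%:E.

(* Topological support of the law of Y.  (The set of atoms would not do here:
   it is empty, hence contained in every lattice, for an atomless law.) *)
Definition law_support (Y : {RV P >-> R}) : set R :=
  [set y | forall U : set R, open U -> U y -> (0 < distribution P Y U)%E].

Definition lattice_span (Y : {RV P >-> R}) (h : R) : Prop :=
  0 < h /\
  exists a : R, law_support Y `<=` [set y | exists k : int, y = a + k%:~R * h].

Definition maximal_span (Y : {RV P >-> R}) (h : R) : Prop :=
  lattice_span Y h /\ forall h' : R, lattice_span Y h' -> h' <= h.

Definition mutually_independent (X : nat -> {RV P >-> R}) : Prop :=
  forall (J : {fset nat}) (B : nat -> set R),
    (forall i, i \in J -> measurable (B i)) ->
    P (\bigcap_(i in [set` J]) X i @^-1` B i) =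
    (\prod_(i <- J) P (X i @^-1` B i))%E.

Definition identically_distributed (X : nat -> {RV P >-> R}) : Prop :=
  forall (i j : nat) (B : set R), measurable B ->
    distribution P (X i) B = distribution P (X j) B.

Definition iid (X : nat -> {RV P >-> R}) : Prop :=
  mutually_independent X /\ identically_distributed X.

(* Indices are shifted by one: X i stands for X_{i+1}, so that this is
   X_1 + ... + X_n. *)
Definition partial_sum (X : nat -> {RV P >-> R}) (n : nat) : {RV P >-> R} :=
  \sum_(i < n) X i.

End definitions.

(* Main.v *)
(** Off a null set X_i = a + h K_i with integer-valued i.i.d. K_i, and entropy is invariant
    under the injection k |-> n a + h k, so that H(S_n) is the entropy of the law p_n of the
    random walk K_1 + ... + K_n, with mean n m and variance n v, v = sigma^2 / h^2.

    Upper bound: Gibbs' inequality against the discretised Gaussian of mean n m and variance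
    n v, whose normalising constant is sqrt (2 pi n v) (1 + o(1)).

    Lower bound: let f_n (x) = sqrt n * p_n (floor (x sqrt n + n m)), a probability density.
    Maximality of the span makes the steps aperiodic, so that the characteristic function of
    the centred step is bounded by a Gaussian on [-pi, pi]; Fourier inversion and dominated
    convergence then show that f_n is bounded by some M and converges pointwise to the centred
    Gaussian density f of variance v.  Fatou's lemma for the nonnegative functions
    f_n ln (M / f_n) gives liminf (H(S_n) - ln sqrt n) >= - int f ln f
    = ln sqrt (2 pi e v). *)

Require Import Defs.
From HB Require Import structures.
From mathcomp Require Import all_boot all_order all_algebra.
From mathcomp Require Import finmap ring lra.
From mathcomp Require Import all_classical all_reals all_analysis.
From mathcomp Require Import measurable_realfun.

Set Implicit Arguments.
Unset Strict Implicit.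
Unset Printing Implicit Defensive.

Import Order.TTheory GRing.Theory Num.Theory.
Import numFieldNormedType.Exports.

Local Open Scope classical_set_scope.
Local Open Scope ring_scope.

(** Pointwise convergence of densities does not by itself give convergence of entropies: a little
    mass far out may carry much entropy, so Fatou's lemma yields only one inequality. The variance
    controls the tails, and since a Gaussian maximises entropy at given variance, Gibbs' inequality
    turns this control into exactly the matching bound.

    Aperiodicity becomes decay quantitatively. With [phi] the characteristic function,
    [1 - |phi t|^2] dominates a multiple of the mean of [sin ((K - j0) t / 2) ^+ 2], hence of
    [sin (j t / 2) ^+ 2] for every difference [j] between an atom and [j0]. Such bounds are
    inherited by the subgroup generated by these [j], which contains [1], and [sin (t / 2) ^+ 2] is
    of order [t ^+ 2] on [[-pi, pi]].

    Fourier analysis is done over the reals, with pairs for the powers of [phi]. Mean and variance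
    enter through one family of identities, [E (K - m + c)^2 = v + c^2] for all [c], which speaks
    only of integrals of nonnegative functions. *)

(** * Dominated convergence and measurability for real-valued functions *)

Lemma Rdominated_cvg d (T : measurableType d) (R : realType)
    (mu : {measure set T -> \bar R}) (f_ : nat -> T -> R) (f g : T -> R) :
  (forall n, measurable_fun setT (f_ n)) ->
  (forall x, f_ n x @[n --> \oo] --> f x) ->
  mu.-integrable setT (EFin \o g) ->
  (forall n x, `|f_ n x| <= g x) ->
  \int[mu]_x f_ n x @[n --> \oo] --> \int[mu]_x f x.
Proof.
move=> mf_ f_f ig f_g.
have mf : measurable_fun setT f.
  by apply: (measurable_fun_cvg (h := f_)) => // x _; exact: f_f.
have f_fE : {ae mu, forall x, setT x -> (f_ n x)%:E @[n --> \oo] --> (f x)%:E}.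
  by apply: aeW => x _; apply: cvg_EFin; [exact: nearW|exact: f_f].
have f_gE : {ae mu, forall x n, setT x -> (`|(f_ n x)%:E| <= (g x)%:E)%E}.
  by apply: aeW => x n _; rewrite lee_fin.
have [intf _ cvgf] := dominated_convergence measurableT
  (fun n => (measurable_EFinP _ _).2 (mf_ n)) ((measurable_EFinP _ _).2 mf)
  f_fE ig f_gE.
apply: (fine_cvg (f := fun n => (\int[mu]_x (f_ n x)%:E)%E)).
rewrite fineK; last exact: integrable_fin_num.
exact: cvgf.
Qed.

Section measurability.
Context d (T : measurableType d) (R : realType).
Implicit Types (D : set T) (f g : T -> R).

Lemma measurable_fun_cos D f : measurable_fun D f -> measurable_fun D (fun x => cos (f x)).
Proof.
move=> mf; apply: (measurableT_comp (f := cos)) => //.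
by apply: continuous_measurable_fun; exact: continuous_cos.
Qed.

Lemma measurable_fun_sin D f : measurable_fun D f -> measurable_fun D (fun x => sin (f x)).
Proof.
move=> mf; apply: (measurableT_comp (f := sin)) => //.
by apply: continuous_measurable_fun; exact: continuous_sin.
Qed.

Lemma measurable_fun_norm D f : measurable_fun D f -> measurable_fun D (fun x => `|f x|).
Proof. by move=> mf; apply: measurableT_comp => //; exact: normr_measurable. Qed.

Lemma measurable_fun_expR D f : measurable_fun D f -> measurable_fun D (fun x => expR (f x)).
Proof. by move=> mf; apply: (measurableT_comp (f := expR)). Qed.

Context (mu : {measure set T -> \bar R}).

Lemma integrable_EFinD f g : mu.-integrable setT (EFin \o f) ->
  mu.-integrable setT (EFin \o g) -> mu.-integrable setT (EFin \o (fun x => f x + g x)).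
Proof. by move=> ? ?; exact: (@integrableD _ _ _ _ _ _ (EFin \o f) (EFin \o g)). Qed.

Lemma integrable_EFinB f g : mu.-integrable setT (EFin \o f) ->
  mu.-integrable setT (EFin \o g) -> mu.-integrable setT (EFin \o (fun x => f x - g x)).
Proof. by move=> ? ?; exact: (@integrableB _ _ _ _ _ _ (EFin \o f) (EFin \o g)). Qed.

Lemma integrable_EFinZl c f : mu.-integrable setT (EFin \o f) ->
  mu.-integrable setT (EFin \o (fun x => c * f x)).
Proof. by move=> ?; exact: (@integrableZl _ _ _ _ _ _ c (EFin \o f)). Qed.

Lemma le_integrable_EFin f g : measurable_fun setT f -> (forall x, `|f x| <= g x) ->
  mu.-integrable setT (EFin \o g) -> mu.-integrable setT (EFin \o f).
Proof.
move=> mf fg; apply: le_integrable => //; first exact/measurable_EFinP.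
by move=> x _; rewrite /= lee_fin (le_trans (fg x))// ler_norm.
Qed.

End measurability.

Ltac mfun := repeat first
  [ assumption | exact: measurable_cst | exact: measurable_id
  | apply: measurable_funD | apply: measurable_funB | apply: measurable_funM
  | apply: measurable_funN | apply: measurable_funX
  | apply: measurable_fun_cos | apply: measurable_fun_sin
  | apply: measurable_fun_norm | apply: measurable_fun_expR ].

(** * Gaussian integrals *)

Section gaussian.
Context {R : realType}.
Notation mu := (@lebesgue_measure R).
Implicit Types (m v x y c : R).

(** Integration by parts on the whole line, in disguise: for a product [G] that vanishes at infinity
    it moves the derivative to the other factor. The integrals over [[-n, n]] are increments of [G],
    and [|g|] dominates the passage to the limit. *)
Lemma Rintegral_derive_eq0 (G g : R -> R) :
  (forall x : R, is_derive x (1 : R) G (g x)) -> continuous g ->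
  mu.-integrable [set: R] (EFin \o g) ->
  G n%:R @[n --> \oo] --> 0 -> G (- n%:R) @[n --> \oo] --> 0 ->
  \int[mu]_x g x = 0.
Proof.
move=> dG cg ig G0 GN0.
have mg : measurable_fun [set: R] g by exact: continuous_measurable_fun.
have h : \int[mu]_x (g \_ `[- n%:R, n%:R]) x @[n --> \oo] --> \int[mu]_x g x.
  apply: (@Rdominated_cvg _ _ R mu _ _ (fun x => `|g x|)).
  - by move=> n; apply/(measurable_restrictT _ _).1 => //; exact: measurable_funTS.
  - move=> x; apply: cvg_near_cst; near=> n.
    rewrite patchE mem_set//= in_itv/= -ler_norml.
    by near: n; exact: nbhs_infty_ger.
  - by apply: integrable_norm.
  - move=> n x; rewrite patchE; case: ifPn => //= _.
    by rewrite normr0.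
have h0 : \int[mu]_x (g \_ `[- n%:R, n%:R]) x @[n --> \oo] --> 0 - 0.
  apply: cvg_trans (cvgB G0 GN0); apply: near_eq_cvg; near=> n.
  have n0 : (0 : R) < n%:R by rewrite ltr0n; near: n; exact: nbhs_infty_gt.
  have cG : continuous G.
    by move=> x; apply/differentiable_continuous/derivable1_diffP; case: (dG x).
  rewrite -Rintegral_mkcond /Rintegral (@continuous_FTC2 _ g G)//.
  - by rewrite (lt_trans _ n0)// oppr_lt0.
  - by apply: continuous_subspaceT.
  - split; last 2 first.
    + by apply: cvg_at_right_filter; exact: cG.
    + by apply: cvg_at_left_filter; exact: cG.
    by move=> x _; case: (dG x).
  - by move=> x _; rewrite derive1E; apply: derive_val.
by rewrite -(cvg_lim _ h)// (cvg_lim _ h0)// subr0.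
Unshelve. all: by end_near. Qed.

(** Left unnormalised because it serves in three roles: as a density, as a Fourier transform (with
    variance [v^-1]), and as a decay bound. *)
Definition gauss (m v x : R) : R := expR (- ((x - m) ^+ 2 / (2 * v))).

Lemma gauss_gt0 m v x : 0 < gauss m v x.
Proof. exact: expR_gt0. Qed.

Lemma gauss_ge0 m v x : 0 <= gauss m v x.
Proof. exact: expR_ge0. Qed.

Lemma gauss_normal_pdf m v : 0 < v ->
  gauss m v = (fun x => Num.sqrt (2 * pi * v) * normal_pdf m (Num.sqrt v) x).
Proof.
move=> v0; apply/funext => x.
rewrite normal_pdfE ?gt_eqF ?sqrtr_gt0// /normal_peak /normal_fun sqr_sqrtr ?ltW//.
rewrite mulrA (_ : v * pi *+ 2 = 2 * pi * v); last by rewrite -mulr_natl; ring.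
rewrite divff ?mul1r; last by rewrite gt_eqF// sqrtr_gt0 !mulr_gt0// pi_gt0.
by rewrite /gauss -[v *+ 2]mulr_natl mulNr.
Qed.

Lemma integrable_gauss m v : 0 < v ->
  mu.-integrable [set: R] (EFin \o gauss m v).
Proof.
move=> v0; rewrite gauss_normal_pdf//.
under [X in integrable _ _ X]eq_fun do rewrite /= EFinM.
by apply: integrableZl => //; exact: integrable_normal_pdf.
Qed.

Lemma integral_gauss m v : 0 < v ->
  (\int[mu]_x (gauss m v x)%:E = (Num.sqrt (2 * pi * v))%:E)%E.
Proof.
move=> v0; rewrite gauss_normal_pdf//.
under eq_integral do rewrite EFinM.
by rewrite integralZl ?integral_normal_pdf ?mule1//; exact: integrable_normal_pdf.
Qed.

Lemma is_derive_gauss m v x : v != 0 ->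
  is_derive x (1 : R) (gauss m v) (- ((x - m) / v) * gauss m v x).
Proof.
move=> v0; rewrite /gauss.
apply: is_derive_eq.
by rewrite /GRing.scale/=; field.
Qed.

Lemma continuous_gauss m v : continuous (gauss m v).
Proof.
move=> x; rewrite /gauss; apply: continuous_comp; last exact: continuous_expR.
apply: cvgN; apply: cvgMl; under eq_fun do rewrite expr2.
by apply: cvgM; (apply: cvgB; [exact: cvg_id|exact: cvg_cst]).
Qed.

Lemma measurable_gauss m v : measurable_fun [set: R] (gauss m v).
Proof. by apply: continuous_measurable_fun; exact: continuous_gauss. Qed.

(* [z <= expR z] at [z = x ^+ 2 / (4 * v)], so that a factor [x ^+ 2] costs only
   half of the exponent. *)
Lemma sqr_gauss_le v x : 0 < v -> x ^+ 2 * gauss 0 v x <= 4 * v * gauss 0 (2 * v) x.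
Proof.
move=> v0; rewrite /gauss subr0.
have -> : - (x ^+ 2 / (2 * v)) = - (x ^+ 2 / (2 * (2 * v))) - (x ^+ 2 / (2 * (2 * v))).
  by field; rewrite gt_eqF.
rewrite expRD mulrA [leRHS]mulrC [leLHS]mulrC ler_wpM2l ?expR_ge0//.
have -> : x ^+ 2 = 4 * v * (x ^+ 2 / (2 * (2 * v))) by field; rewrite gt_eqF.
set z := x ^+ 2 / _.
rewrite (_ : 4 * v * z / (2 * (2 * v)) = z); last by field; rewrite gt_eqF.
rewrite -mulrA -[leRHS]mulr1; apply: ler_wpM2l; first by rewrite mulr_ge0// ltW.
rewrite expRN ler_pdivrMr ?expR_gt0// mul1r.
by rewrite (le_trans _ (expR_ge1Dx _))// lerDr.
Qed.

Lemma integrable_sqr_gauss v : 0 < v ->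
  mu.-integrable [set: R] (EFin \o (fun x => x ^+ 2 * gauss 0 v x)).
Proof.
move=> v0; have v20 : 0 < 2 * v by rewrite mulr_gt0.
apply: le_integrable_EFin (integrable_EFinZl (4 * v) (integrable_gauss 0 v20)).
  by apply: measurable_funM; [exact: measurable_funX|exact: measurable_gauss].
move=> x; rewrite ger0_norm ?sqr_gauss_le//.
by rewrite mulr_ge0 ?gauss_ge0 ?sqr_ge0.
Qed.

Lemma integrable_mulr_gauss v (w : R -> R) c : 0 < v -> measurable_fun [set: R] w ->
  (forall x, `|w x| <= c * (1 + x ^+ 2)) ->
  mu.-integrable [set: R] (EFin \o (fun x => w x * gauss 0 v x)).
Proof.
move=> v0 mw wc.
apply: le_integrable_EFin (integrable_EFinZl c
  (integrable_EFinD (integrable_gauss 0 v0) (integrable_sqr_gauss v0))).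
  by apply: measurable_funM => //; exact: measurable_gauss.
move=> x; rewrite normrM (ger0_norm (gauss_ge0 _ _ _)).
rewrite -{2}[gauss 0 v x]mul1r -mulrDl mulrA ler_wpM2r ?gauss_ge0//.
Qed.

(** These are the boundary terms of the integrations by parts below, with [w] the identity or a
    sine. *)
Lemma cvg_mulr_gauss v (w : R -> R) : 0 < v ->
  (forall x, `|w x| <= 1 + `|x|) ->
  w n%:R * gauss 0 v n%:R @[n --> \oo] --> 0 /\
  w (- n%:R) * gauss 0 v (- n%:R) @[n --> \oo] --> 0.
Proof.
move=> v0 wx.
have key (s : nat -> R) : (forall n, `|s n| = n%:R) ->
    w (s n) * gauss 0 v (s n) @[n --> \oo] --> 0.
  move=> sn; apply: norm_cvg0.
  (* For [n >= 1], [n (1 + n)] is at most [2 n^2], and [sqr_gauss_le] bounds [n^2] times the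
     Gaussian by [4 v]; hence [8 v / n]. *)
  have h : (8 * v) * n%:R^-1 @[n --> \oo] --> (8 * v) * (0 : R).
    by apply: cvgMr; apply/gtr0_cvgV0; [near=> n; rewrite ltr0n; near: n; exact: nbhs_infty_gt|exact: cvgr_idn].
  rewrite mulr0 in h.
  apply: (squeeze_cvgr _ (cvg_cst 0) h); near=> n.
  rewrite normr_ge0/= normrM (ger0_norm (gauss_ge0 _ _ _)).
  have n0 : (0 : R) < n%:R by rewrite ltr0n; near: n; exact: nbhs_infty_gt.
  rewrite ler_pdivlMr// (le_trans (ler_wpM2r (ltW n0) (ler_wpM2r (gauss_ge0 _ _ _) (wx _))))//.
  have n1 : (1 : R) <= n%:R by rewrite ler1n; near: n; exact: nbhs_infty_gt.
  have gs := sqr_gauss_le (s n) v0; rewrite -[_ ^+ 2]real_normK ?num_real// sn in gs.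
  have g1 : gauss 0 (2 * v) (s n) <= 1.
    by rewrite /gauss -expR0 ler_expR lerNl oppr0 divr_ge0 ?sqr_ge0// !mulr_ge0// ltW.
  have h1 : 4 * v * gauss 0 (2 * v) (s n) <= 4 * v by rewrite ler_piMr// mulr_ge0// ltW.
  have h2 : n%:R * gauss 0 v (s n) <= n%:R ^+ 2 * gauss 0 v (s n).
    by rewrite ler_wpM2r ?gauss_ge0// expr2 ler_peMr// ltW.
  rewrite sn mulrDl mul1r mulrDl [X in X + _]mulrC mulrAC -expr2; lra.
split; apply: key => n; first by rewrite ger0_norm.
by rewrite normrN ger0_norm.
Unshelve. all: by end_near. Qed.

(** The function [g] of the proof is the derivative of [x * gauss 0 v x], so its integral
    vanishes. *)
Lemma integral_sqr_gauss v : 0 < v ->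
  \int[mu]_x (x ^+ 2 * gauss 0 v x) = v * Num.sqrt (2 * pi * v).
Proof.
move=> v0; have vn0 : v != 0 by rewrite gt_eqF.
pose g x := gauss 0 v x - v^-1 * (x ^+ 2 * gauss 0 v x).
have ig1 := integrable_gauss 0 v0; have ig2 := integrable_sqr_gauss v0.
have ig2' : mu.-integrable [set: R] (EFin \o (fun x => v^-1 * (x ^+ 2 * gauss 0 v x))).
  exact: integrable_EFinZl.
have [c1 c2] := @cvg_mulr_gauss v id v0 (fun x => ler_wpDl ler01 (lexx _)).
have : \int[mu]_x g x = 0.
  apply: (@Rintegral_derive_eq0 (fun x => x * gauss 0 v x)) => //.
  - move=> x; have dg := is_derive_gauss 0 x vn0.
    by apply: is_derive_eq; rewrite /g /GRing.scale/=; field.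
  - move=> x; apply: cvgB; first exact: continuous_gauss.
    apply: cvgMr; apply: cvgM; last exact: continuous_gauss.
    exact: sqr_continuous.
  - exact: integrable_EFinB.
rewrite RintegralB// RintegralZl// [X in X - _]/Rintegral integral_gauss//=.
by move/eqP; rewrite subr_eq0 => /eqP ->; rewrite mulrA divff// mul1r.
Qed.

Lemma continuous_cosM y : continuous (fun x : R => cos (x * y)).
Proof.
move=> x; apply: continuous_comp; last exact: continuous_cos.
by apply: cvgMl; exact: cvg_id.
Qed.

Lemma continuous_sinM y : continuous (fun x : R => sin (x * y)).
Proof.
move=> x; apply: continuous_comp; last exact: continuous_sin.
by apply: cvgMl; exact: cvg_id.
Qed.

(** The transform [F] solves the differential equation [F' z = - v z F z]: differentiate under the
    integral, then integrate by parts. Hence [F z * expR (v * z ^+ 2 / 2)] is constant, and its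
    value at [0] is the Gaussian integral. *)
Lemma fourier_gauss v y : 0 < v ->
  \int[mu]_x (cos (x * y) * gauss 0 v x) = Num.sqrt (2 * pi * v) * gauss 0 v^-1 y.
Proof.
move=> v0; have vn0 : v != 0 by rewrite gt_eqF.
have ic z : mu.-integrable [set: R] (EFin \o (fun x => cos (x * z) * gauss 0 v x)).
  apply: (@integrable_mulr_gauss _ _ 1) => //; first by mfun.
  by move=> x; rewrite mul1r (le_trans (cos_max _))// lerDl sqr_ge0.
have ix z : mu.-integrable [set: R] (EFin \o (fun x => x * sin (x * z) * gauss 0 v x)).
  apply: (@integrable_mulr_gauss _ _ 1) => //; first by mfun.
  move=> x; rewrite mul1r normrM (le_trans (ler_wpM2l _ (sin_max _)))// mulr1.
  by rewrite -real_normK ?num_real//; have := sqr_ge0 (`|x| - 2^-1); lra.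
pose F z := \int[mu]_x (cos (x * z) * gauss 0 v x).
have parts z : \int[mu]_x (x * sin (x * z) * gauss 0 v x) = v * z * F z.
  pose g x := z * (cos (x * z) * gauss 0 v x) - v^-1 * (x * sin (x * z) * gauss 0 v x).
  have i1 := integrable_EFinZl z (ic z).
  have i2 := integrable_EFinZl v^-1 (ix z).
  have [c1 c2] : (sin (n%:R * z) * gauss 0 v n%:R @[n --> \oo] --> 0 /\
      sin (- n%:R * z) * gauss 0 v (- n%:R) @[n --> \oo] --> 0).
    by apply: (cvg_mulr_gauss v0 (w := fun x => sin (x * z))) => x; rewrite (le_trans (sin_max _))// lerDl.
  have : \int[mu]_x g x = 0.
    apply: (@Rintegral_derive_eq0 (fun x => sin (x * z) * gauss 0 v x)) => //.
    - move=> x; have dg := is_derive_gauss 0 x vn0.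
      by apply: is_derive_eq; rewrite /g /GRing.scale/=; field.
    - move=> x; apply: cvgB.
        by apply: cvgMr; apply: cvgM; [exact: continuous_cosM|exact: continuous_gauss].
      apply: cvgMr; apply: cvgM; last exact: continuous_gauss.
      by apply: cvgM; [exact: cvg_id|exact: continuous_sinM].
    - exact: integrable_EFinB.
  rewrite RintegralB// !RintegralZl//.
  rewrite -/(F z) => /eqP; rewrite subr_eq0 => /eqP E.
  by rewrite -mulrA E mulrA divff// mul1r.
pose f z x := cos (x * z) * gauss 0 v x.
have d1f z x : partial1of2 f z x = - (x * sin (x * z) * gauss 0 v x).
  rewrite partial1of2E.
  have h : is_derive z (1 : R) (f^~ x) (- (x * sin (x * z) * gauss 0 v x)).
    by apply: is_derive_eq; rewrite /GRing.scale/=; ring.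
  exact: derive_val.
have dF z : is_derive z (1 : R) F (- (v * z * F z)).
  have Iz : `]z - 1, z + 1[%classic z.
    by rewrite /= in_itv/= ltrBlDr ltrDl ltr01.
  have derf x' x : `]z - 1, z + 1[%classic x' -> [set: R] x -> derivable (f ^~ x) x' 1.
    by move=> _ _; exact: ex_derive.
  have iG : mu.-integrable [set: R] (EFin \o (fun x => (1 + x ^+ 2) * gauss 0 v x)).
    apply: (@integrable_mulr_gauss _ _ 1) => //; first by mfun.
    by move=> x; rewrite mul1r ger0_norm// addr_ge0// sqr_ge0.
  have G0 x : 0 <= (1 + x ^+ 2) * gauss 0 v x.
    by rewrite mulr_ge0 ?gauss_ge0// addr_ge0// sqr_ge0.
  have Gub x' x : `]z - 1, z + 1[%classic x' -> [set: R] x ->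
      `|partial1of2 f x' x| <= (1 + x ^+ 2) * gauss 0 v x.
    move=> _ _; rewrite d1f normrN normrM (ger0_norm (gauss_ge0 _ _ _)).
    rewrite ler_wpM2r ?gauss_ge0//.
    rewrite normrM (le_trans (ler_wpM2l _ (sin_max _)))// mulr1.
    by rewrite -real_normK ?num_real//; have := sqr_ge0 (`|x| - 2^-1); lra.
  have intf x' (_ : `]z - 1, z + 1[%classic x') := ic x'.
  split.
    exact: (derivable_under_integral measurableT Iz intf derf G0 iG Gub).
  have := differentiation_under_integral measurableT Iz intf derf G0 iG Gub.
  rewrite derive1E => ->.
  rewrite -parts -mulN1r -RintegralZl//.
  by apply: eq_Rintegral => x _; rewrite d1f mulN1r.
have H0 : F y * expR (v * y ^+ 2 / 2) = F 0 * expR (v * 0 ^+ 2 / 2).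
  apply: (@is_derive_0_is_cst _ (fun z => F z * expR (v * z ^+ 2 / 2))) => z.
  by apply: is_derive_eq; rewrite /GRing.scale/=; field.
have F0 : F 0 = Num.sqrt (2 * pi * v).
  rewrite /F -[RHS]/(fine (Num.sqrt (2 * pi * v))%:E) -(integral_gauss 0 v0).
  by apply: eq_Rintegral => x _; rewrite mulr0 cos0 mul1r.
rewrite -/(F y) -F0 /gauss subr0 expRN.
have -> : y ^+ 2 / (2 / v) = v * y ^+ 2 / 2 by field.
have e0 : expR (v * 0 ^+ 2 / 2) = 1 by rewrite expr0n/= mulr0 mul0r expR0.
rewrite e0 mulr1 in H0.
by rewrite -H0 mulfK// gt_eqF// expR_gt0.
Qed.

End gaussian.

(** * Trigonometric inequalities *)

Section trigonometric_bounds.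
Context {R : realType}.
Implicit Types x y z t : R.

Lemma MVT0 (f df : R -> R) z : (forall x : R, is_derive x (1 : R) f (df x)) ->
  exists2 x, `|x| <= `|z| & f z - f 0 = df x * z.
Proof.
move=> fdf.
have cf : continuous f.
  by move=> x; apply/differentiable_continuous/derivable1_diffP; case: (fdf x).
have [z0|/ltW z0] := leP 0 z.
- have [x] := @MVT_segment _ f df 0 z z0 (fun x _ => fdf x) (continuous_subspaceT cf).
  rewrite in_itv/= => /andP[x0 xz] E; exists x; last by rewrite E subr0.
  by rewrite !ger0_norm.
- have [x] := @MVT_segment _ f df z 0 z0 (fun x _ => fdf x) (continuous_subspaceT cf).
  rewrite in_itv/= => /andP[zx x0] E; exists x; last first.
    by apply: oppr_inj; rewrite opprB E sub0r mulrN.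
  by rewrite !ler0_norm// lerN2.
Qed.

Lemma norm_sin_le z : `|sin z| <= `|z|.
Proof.
have [x _] := @MVT0 sin cos z (fun x => is_derive_sin x).
rewrite sin0 subr0 => ->; rewrite normrM ler_piMl//; exact: cos_max.
Qed.

Lemma onem_cosE z : 1 - cos z = 2 * sin (z / 2) ^+ 2.
Proof.
have z2 : z / 2 *+ 2 = z by rewrite -mulr_natr divfK.
by have := cos_mulr2n (z / 2); rewrite z2 cos2sin2 -mulr_natl => ->; ring.
Qed.

Lemma onem_cos_le z : 1 - cos z <= z ^+ 2 / 2.
Proof.
rewrite onem_cosE.
have := norm_sin_le (z / 2); rewrite -(@ler_sqr _ _ `|z / 2|) ?nnegrE//.
by rewrite !real_normK ?num_real// expr_div_n; lra.
Qed.

Lemma onem_cos_ge0 z : 0 <= 1 - cos z.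
Proof. by rewrite subr_ge0 cos_le1. Qed.

Lemma norm_sinB_le3 z : `|sin z - z| <= `|z| ^+ 3 / 2.
Proof.
have [x xz] := @MVT0 (fun x => sin x - x) (fun x => cos x - 1) z _.
  rewrite sin0 !subr0 => ->; rewrite normrM (exprSr _ 2) mulrAC ler_wpM2r//.
  rewrite distrC ger0_norm ?onem_cos_ge0// (le_trans (onem_cos_le x))//.
  rewrite ler_wpM2r// ?invr_ge0// -[x ^+ 2]real_normK ?num_real//.
  by rewrite ler_sqr ?nnegrE.
Qed.

(** Only second moments are available, so dominated convergence in [cvg_imcf] needs a quadratic
    bound, while [norm_sinB_le3] gives the pointwise limit there. For [|z| <= 2] it follows from the
    cubic bound, beyond that from [2 * |z|]. *)
Lemma norm_sinB_le2 z : `|sin z - z| <= z ^+ 2.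
Proof.
rewrite -[z ^+ 2]real_normK ?num_real//.
have h3 := norm_sinB_le3 z.
have h1 : `|sin z - z| <= 2 * `|z|.
  by rewrite (le_trans (ler_normB _ _))// mulr2n mulrDl mul1r lerD2r norm_sin_le.
have z0 := normr_ge0 z; set a := `|z| in h1 h3 z0 *.
have [a2|/ltW a2] := leP a 2.
- rewrite (le_trans h3)// (exprSr _ 2) -mulrA ler_piMr ?sqr_ge0//; lra.
- by rewrite (le_trans h1)// expr2 ler_wpM2r.
Qed.

Lemma norm_cosB_le4 z : `|cos z - 1 + z ^+ 2 / 2| <= z ^+ 4 / 2.
Proof.
have dcos (x : R) : is_derive x (1 : R) (fun x => cos x + x ^+ 2 / 2) (- (sin x - x)).
  by apply: is_derive_eq; rewrite /GRing.scale/=; field.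
have [x xz] := MVT0 z dcos.
rewrite cos0 expr0n/= mul0r addr0 => E.
have -> : cos z - 1 + z ^+ 2 / 2 = cos z + z ^+ 2 / 2 - 1 by ring.
rewrite E normrM normrN.
have -> : z ^+ 4 = `|z| ^+ 4.
  by rewrite -[4%N]/(2 * 2)%N !exprM real_normK ?num_real.
have -> : `|z| ^+ 4 / 2 = `|z| ^+ 3 / 2 * `|z| by field.
rewrite ler_wpM2r// (le_trans (norm_sinB_le3 x))//.
by rewrite ler_wpM2r ?invr_ge0// lerXn2r ?nnegrE.
Qed.

(* [sin x = 2 sin (x/2) cos (x/2)] and [y cos y <= sin y] give
   [x cos (x/2) ^+ 2 <= sin x], where [cos (x/2) ^+ 2 = (1 + cos x)/2]. *)
Lemma sin_ge_half x : 0 <= x <= pi / 2 -> x / 2 <= sin x.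
Proof.
move=> /andP[x0 xpi]; pose y := x / 2.
have pi0 : 0 < pi :> R := pi_gt0 _.
have y0 : 0 <= y by rewrite divr_ge0.
have ypi : y <= pi / 2 by rewrite /y; lra.
have cosy : 0 <= cos y by apply: cos_ge0_pihalf; lra.
have siny : y * cos y <= sin y.
  have [c cy] := @MVT0 sin cos y (fun x => is_derive_sin x).
  rewrite sin0 subr0 => ->; rewrite mulrC ler_wpM2r//.
  rewrite -(cos_norm c) leNgt ltr_cos ?in_itv/= -?leNgt.
  - by rewrite -[leRHS](ger0_norm y0).
  - by rewrite y0/=; lra.
  - by rewrite normr_ge0/= (le_trans cy)// ger0_norm//; lra.
have cosx : 0 <= cos x by apply: cos_ge0_pihalf; lra.
have y2 : y *+ 2 = x by rewrite -mulr_natr divfK.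
have -> : sin x = 2 * (cos y * sin y).
  by rewrite mulr_natl -sin_mulr2n y2.
have Ecos : cos x = 2 * cos y ^+ 2 - 1.
  by have := cos_mulr2n y; rewrite y2 -mulr_natl => ->.
have := ler_wpM2l cosy siny.
have -> : cos y * (y * cos y) = y * cos y ^+ 2 by ring.
have -> : cos y ^+ 2 = (1 + cos x) / 2 by rewrite Ecos; field.
rewrite -[x / 2]/y.
have := mulr_ge0 y0 cosx; lra.
Qed.

Lemma sqr_sin_half_ge t : `|t| <= pi -> t ^+ 2 / 16 <= sin (t / 2) ^+ 2.
Proof.
move=> tpi.
have := @sin_ge_half (`|t| / 2).
rewrite divr_ge0//= ler_wpM2r ?invr_ge0// => /(_ isT) h.
have -> : sin (t / 2) ^+ 2 = sin (`|t| / 2) ^+ 2.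
  by have [t0|t0] := ger0P t; rewrite ?mulNr ?sinN ?sqrrN.
have -> : t ^+ 2 / 16 = (`|t| / 2 / 2) ^+ 2.
  by rewrite !expr_div_n real_normK ?num_real//; field.
by rewrite ler_sqr ?nnegrE ?divr_ge0// (le_trans _ h)// !divr_ge0.
Qed.

(** This quasi-triangle inequality makes the set of integers considered in [cf_decay] closed under
    subtraction. *)
Lemma sqr_sinD_le x y : sin (x + y) ^+ 2 <= 2 * sin x ^+ 2 + 2 * sin y ^+ 2.
Proof.
rewrite sinD; have := cos_max x; have := cos_max y.
set a := sin x; set b := sin y; set c := cos x; set e := cos y => he hc.
have ce : c ^+ 2 <= 1 by rewrite -[c ^+ 2]real_normK ?num_real// expr_le1.
have ee : e ^+ 2 <= 1 by rewrite -[e ^+ 2]real_normK ?num_real// expr_le1.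
have := sqr_ge0 (a * e - c * b).
have h1 : (a * e) ^+ 2 <= a ^+ 2 by rewrite exprMn ler_piMr ?sqr_ge0.
have h2 : (c * b) ^+ 2 <= b ^+ 2 by rewrite exprMn ler_piMl ?sqr_ge0.
rewrite sqrrB sqrrD; lra.
Qed.

End trigonometric_bounds.

(** * Subgroups of the integers *)

Section int_subgroup.

(** The generator is the least positive member, or [0] if there is none. The remainder of a member
    modulo it is again a member, so it vanishes by minimality. *)
Lemma int_subgroup_gen (G : int -> Prop) (m0 : int) :
  (forall m n, G m -> G n -> G (m - n)) -> G m0 ->
  exists2 d : nat, G d%:Z & forall m, G m -> (d%:Z %| m)%Z.
Proof.
move=> GB Gm0.
have G0 : G 0 by rewrite -(subrr m0); exact: GB.
have GN m : G m -> G (- m) by move=> Gm; rewrite -sub0r; exact: GB.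
have GD m n : G m -> G n -> G (m + n).
  by move=> Gm Gn; rewrite -[n]opprK; apply: GB => //; exact: GN.
have GM (d : int) : G d -> forall k : nat, G (k%:Z * d).
  move=> Gd; elim=> [|k IH]; first by rewrite mul0r.
  by rewrite -addn1 PoszD mulrDl mul1r; exact: GD.
have GZ (d k : int) : G d -> G (k * d).
  move=> Gd; case: k => k; first exact: GM.
  by rewrite NegzE mulNr; apply: GN; exact: GM.
have Gabs m : G m -> G `|m|%N%:Z.
  by rewrite abszE => Gm; have [_|_] := ger0P m => //; exact: GN.
have [[d [d0 Gd]]|nd] := pselect (exists d : nat, (0 < d)%N /\ G d%:Z); last first.
  exists 0%N => // m Gm; have [->//|m0'] := eqVneq m 0.
  by exfalso; apply: nd; exists `|m|%N; rewrite absz_gt0; split => //; exact: Gabs.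
have ex : exists d : nat, `[< (0 < d)%N /\ G d%:Z >] by exists d; exact/asboolP.
case: (ex_minnP ex) => e /asboolP[e0 Ge] emin.
exists e => // m Gm; apply/dvdz_mod0P; apply/eqP.
have e0' : e%:Z != 0 by rewrite eqz_nat -lt0n.
have r0 := modz_ge0 m e0'; have re := ltz_mod m e0'.
have Gr : G (m %% e)%Z.
  rewrite (_ : (m %% e)%Z = m - (m %/ e)%Z * e%:Z); first by apply: GB => //; exact: GZ.
  by rewrite {2}(divz_eq m e) addrAC subrr add0r.
move: r0 re Gr; case: (m %% e)%Z => // -[//|r] _ re Gr.
by have := emin _ (asboolT (conj (ltn0Sn r) Gr)); move: re; rewrite ger0_norm// ltz_nat ltnNge => /negbTE ->.
Qed.

End int_subgroup.

(** * Powers of a complex number in real coordinates *)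

Section complex_powers.
Context {R : realType}.
Implicit Types a b w t y : R.

(* Real and imaginary part of [(a + i b) ^+ n]. *)
Fixpoint cpow a b (n : nat) : R * R :=
  if n is m.+1 then
    ((cpow a b m).1 * a - (cpow a b m).2 * b, (cpow a b m).1 * b + (cpow a b m).2 * a)
  else (1, 0).

Lemma cpow_norm a b n :
  (cpow a b n).1 ^+ 2 + (cpow a b n).2 ^+ 2 = (a ^+ 2 + b ^+ 2) ^+ n.
Proof.
elim: n => [|n IH] /=; first by rewrite expr1n expr0n/= addr0 expr0.
by rewrite [RHS]exprSr -IH; ring.
Qed.

Lemma cpow_le1 a b n : a ^+ 2 + b ^+ 2 <= 1 ->
  `|(cpow a b n).1| <= 1 /\ `|(cpow a b n).2| <= 1.
Proof.
move=> ab1; have := cpow_norm a b n.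
have : (a ^+ 2 + b ^+ 2) ^+ n <= 1 by rewrite exprn_ile1// addr_ge0 ?sqr_ge0.
set A := (cpow _ _ _).1; set B := (cpow _ _ _).2 => h E.
have hA := sqr_ge0 A; have hB := sqr_ge0 B.
by split; rewrite -[leRHS]ger0_norm// -ler_sqr ?nnegrE// !real_normK ?num_real// expr1n; lra.
Qed.

(** The telescoping estimate [|z^n - w^n| <= n |z - w|] in the unit disc, for [z = a + i b] and real
    [w]. It lets the powers of the characteristic function be compared with those of a real
    exponential, without a complex logarithm. *)
Lemma cpow_approx a b w n : a ^+ 2 + b ^+ 2 <= 1 -> `|w| <= 1 ->
  `|(cpow a b n).1 - w ^+ n| <= n%:R * (`|a - w| + `|b|) /\
  `|(cpow a b n).2| <= n%:R * `|b|.
Proof.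
move=> ab1 w1.
have a1 : `|a| <= 1.
  rewrite -[leRHS]ger0_norm// -ler_sqr ?nnegrE// !real_normK ?num_real// expr1n.
  by have := sqr_ge0 b; lra.
elim: n => [|n [IH1 IH2]] /=; first by rewrite subrr !mul0r normr0.
have [A1 B1] := cpow_le1 n ab1.
set A := (cpow _ _ _).1 in IH1 A1 *; set B := (cpow _ _ _).2 in IH2 B1 *.
split.
- have -> : A * a - B * b - w ^+ n.+1 = (A - w ^+ n) * w + (A * (a - w) - B * b).
    by rewrite exprSr; ring.
  rewrite (le_trans (ler_normD _ _))// -[n.+1]addn1 natrD [leRHS]mulrDl mul1r lerD//.
    by rewrite normrM (le_trans _ IH1)// ler_piMr.
  rewrite (le_trans (ler_normB _ _))// !normrM lerD// ler_piMl//.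
- rewrite (le_trans (ler_normD _ _))// -[n.+1]addn1 natrD [leRHS]mulrDl mul1r addrC !normrM lerD//.
    by rewrite (le_trans _ IH2)// ler_piMr.
  by rewrite ler_piMl.
Qed.

End complex_powers.

(** * Integer-valued functions *)

Section int_series.
Context {R : realType}.
Implicit Types F : int -> \bar R.

(** The zigzag enumeration 0, -1, 1, -2, ..., which turns sums over the integers into series. *)
Definition int_of_nat (n : nat) : int := if odd n then Negz n./2 else Posz n./2.

Definition nat_of_int (z : int) : nat :=
  match z with Posz m => m.*2 | Negz m => m.*2.+1 end.

Lemma int_of_natK : cancel int_of_nat nat_of_int.
Proof.
move=> n; rewrite /int_of_nat; have := odd_double_half n.
by case: (odd n) => /= [|]; rewrite ?add1n ?add0n.
Qed.

Lemma nat_of_intK : cancel nat_of_int int_of_nat.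
Proof.
case=> m; rewrite /int_of_nat/= ?odd_double ?doubleK//=.
by rewrite uphalf_double.
Qed.

Lemma bij_int_of_nat : set_bij [set: nat] [set: int] int_of_nat.
Proof.
split => //; first by move=> m n _ _; exact: (can_inj int_of_natK).
by move=> z _; exists (nat_of_int z) => //; rewrite nat_of_intK.
Qed.

Lemma esum_int F : (forall k, (0 <= F k)%E) ->
  (\esum_(k in [set: int]) F k = \sum_(n <oo) F (int_of_nat n))%E.
Proof.
by move=> F0; rewrite (reindex_esum _ _ _ _ bij_int_of_nat) nneseries_esumT.
Qed.

Lemma esum_int_shift F (j : int) :
  (\esum_(k in [set: int]) F k = \esum_(k in [set: int]) F (k + j)%R)%E.
Proof.
rewrite (reindex_esum [set: int] [set: int] (fun k => k + j))//; split => //.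
  by move=> m n _ _; exact: addIr.
by move=> k _; exists (k - j) => //; rewrite subrK.
Qed.

Context d (T : measurableType d) (mu : {measure set T -> \bar R}).

Lemma integral_esum_int (f : int -> T -> \bar R) :
  (forall k, measurable_fun setT (f k)) -> (forall k x, (0 <= f k x)%E) ->
  ((\int[mu]_x (\esum_(k in [set: int]) f k x)) =
   \esum_(k in [set: int]) \int[mu]_x f k x)%E.
Proof.
move=> mf f0; rewrite esum_int; last by move=> k; exact: integral_ge0.
rewrite -integral_nneseries//.
by apply: eq_integral => x _; rewrite esum_int.
Qed.

Section int_valued.
Variable K : T -> int.
Hypothesis mK : forall k, measurable (K @^-1` [set k]).

(** No sigma-algebra is put on [int]: measurability of the fibres suffices because there are
    countably many. *)
Lemma measurable_int_preimage (A : set int) : measurable (K @^-1` A).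
Proof.
rewrite (_ : K @^-1` A = \bigcup_k (if pselect (A (int_of_nat k)) then
  K @^-1` [set int_of_nat k] else set0)).
  by apply: bigcupT_measurable => k; case: (pselect _) => /=.
apply/seteqP; split => x /= => [AKx|[k _]]; last by case: pselect => //= Ak ->.
by exists (nat_of_int (K x)) => //; rewrite nat_of_intK; case: pselect.
Qed.

Lemma measurable_fun_int d' (T' : measurableType d') (F : int -> T') :
  measurable_fun setT (fun x => F (K x)).
Proof.
by move=> _ B mB; rewrite setTI; exact: (measurable_int_preimage (F @^-1` B)).
Qed.

Lemma trivIset_int_preimage : trivIset [set: nat] (fun n => K @^-1` [set int_of_nat n]).
Proof.
by move=> m n _ _ [x [/= -> /(can_inj int_of_natK)]].
Qed.

Lemma bigcup_int_preimage (B : set T) :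
  B = \bigcup_n (B `&` K @^-1` [set int_of_nat n]).
Proof.
rewrite -setI_bigcupr; apply/seteqP; split => [x Bx|x []//]; split => //.
by exists (nat_of_int (K x)) => //=; rewrite nat_of_intK.
Qed.

Lemma integral_int_partition (f : T -> \bar R) :
  measurable_fun setT f -> (forall x, (0 <= f x)%E) ->
  (\int[mu]_x f x = \esum_(k in [set: int]) \int[mu]_(x in K @^-1` [set k]) f x)%E.
Proof.
move=> mf f0; rewrite esum_int; last by move=> k; exact: integral_ge0.
rewrite {1}(bigcup_int_preimage setT) ge0_integral_bigcup//.
- by apply: eq_eseriesr => n _; rewrite setTI.
- by move=> k; rewrite setTI.
- exact: measurable_funTS.
- by under eq_fun do rewrite setTI; exact: trivIset_int_preimage.
Qed.

Lemma integral_comp_int F : (forall k, (0 <= F k)%E) ->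
  (\int[mu]_x F (K x) = \esum_(k in [set: int]) F k * mu (K @^-1` [set k]))%E.
Proof.
move=> F0; rewrite integral_int_partition//; last exact: measurable_fun_int.
apply: eq_esum => k _; rewrite -integral_cst//.
by apply: eq_integral => x; rewrite inE => /= ->.
Qed.

Lemma measure_int_partition (B : set T) : measurable B ->
  mu B = (\esum_(k in [set: int]) mu (B `&` K @^-1` [set k]))%E.
Proof.
move=> mB; rewrite esum_int// {1}(bigcup_int_preimage B) measure_bigcup//.
- by apply: eq_eseriesl => n; rewrite in_setT.
- by move=> n _; exact: measurableI.
- by apply: trivIset_setIl; exact: trivIset_int_preimage.
Qed.

End int_valued.

End int_series.

(** The limit inferior is the supremum of the infima over tails, so some tail already lies above
    [l - e]. *)
Lemma fatou_real d (T : measurableType d) (R : realType) (mu : {measure set T -> \bar R})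
    (f_ : nat -> T -> R) (f : T -> R) (l e : R) :
  (forall n, measurable_fun setT (f_ n)) -> (forall n x, 0 <= f_ n x) ->
  (forall x, f_ n x @[n --> \oo] --> f x) ->
  (\int[mu]_x (f x)%:E = l%:E)%E -> 0 < e ->
  \forall n \near \oo, ((l - e)%:E <= \int[mu]_x (f_ n x)%:E)%E.
Proof.
move=> mf f0 ff intf e0.
pose g n x := (f_ n x)%:E.
have mg n : measurable_fun setT (g n) by exact/measurable_EFinP.
have := @fatou _ _ _ mu setT measurableT g mg (fun n x _ => f0 n x).
have -> : (\int[mu]_x limn_einf (g ^~ x) = l%:E)%E.
  rewrite -intf; apply: eq_integral => x _.
  apply: (cvg_limn_einf_sup _).1; apply: cvg_EFin; first exact: nearW.
  exact: ff.
rewrite limn_einf_lim; set u := fun n => _.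
rewrite (cvg_lim _ (@cvg_einfs_sup _ u))// => lu.
have : ((l - e)%:E < ereal_sup (range (einfs u)))%E.
  by apply: lt_le_trans lu; rewrite lte_fin ltrBlDr ltrDl.
move=> /ereal_sup_gt[_ [N _ <-]] /ltW leN.
exists N => // n /= Nn; apply: (le_trans leN).
by apply: ereal_inf_lbound; exists n.
Qed.

(** * Lattice sums of the Gaussian *)

Section gaussian_sum.
Context {R : realType}.
Notation mu := (@lebesgue_measure R).
Implicit Types (m v x : R).

Lemma floor_preimage (a b : R) (k : int) : 0 < a ->
  (fun x : R => Num.floor (x * a + b)) @^-1` [set k] =
  `[(k%:~R - b) / a, (k%:~R + 1 - b) / a[%classic.
Proof.
move=> a0; apply/seteqP; split => x /=; rewrite in_itv/=.
- move=> <-; have := floor_itv (x * a + b); rewrite intrD => /andP[h1 h2].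
  by rewrite ler_pdivrMr// ltr_pdivlMr// lerBlDr ltrBrDr h1 h2.
- rewrite ler_pdivrMr// ltr_pdivlMr// lerBlDr ltrBrDr => h.
  by apply: floor_def; rewrite intrD.
Qed.

Lemma measurable_floor_preimage (a b : R) (k : int) : 0 < a ->
  measurable ((fun x : R => Num.floor (x * a + b)) @^-1` [set k]).
Proof. by move=> a0; rewrite floor_preimage//; exact: measurable_itv. Qed.

(** Each cell has length [a^-1]. With [a] the square root of the number of steps, this turns the
    integral of a rescaled step function back into a sum over the lattice. *)
Lemma integral_floor (a b : R) (F : int -> \bar R) : 0 < a -> (forall k, 0 <= F k)%E ->
  (\int[mu]_x F (Num.floor (x * a + b)) = \esum_(k in [set: int]) F k * a^-1%:E)%E.
Proof.
move=> a0 F0.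
rewrite (@integral_comp_int _ _ _ mu (fun x => Num.floor (x * a + b)))//; last first.
  by move=> k; exact: measurable_floor_preimage.
apply: eq_esum => k _; congr (_ * _)%E.
rewrite floor_preimage//= lebesgue_measure_itv/= lte_fin ltr_pM2r ?invr_gt0//.
rewrite ltrD2r ltrDl ltr01 -EFinB -mulrBl; congr (_%:E).
by rewrite (_ : _ - _ = 1) ?mul1r//; ring.
Qed.

(** The unit cell is centred at [k], so the linear term of the tangent line cancels. *)
Lemma integral_affine_cell (c k : R) :
  \int[mu]_(x in `[k - 2^-1, k + 2^-1[) (1 - (x - k) * c) = 1.
Proof.
pose F x := x - c * (x - k) ^+ 2 / 2.
have cf : continuous (fun x : R => 1 - (x - k) * c).
  move=> x; apply: cvgB; first exact: cvg_cst.
  by apply: cvgMl; apply: cvgB; [exact: cvg_id|exact: cvg_cst].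
have dF (x : R) : is_derive x (1 : R) F (1 - (x - k) * c).
  by apply: is_derive_eq; rewrite /GRing.scale/=; field.
have cF : continuous F.
  by move=> x; apply/differentiable_continuous/derivable1_diffP; case: (dF x).
have lt12 : k - 2^-1 < k + 2^-1 by lra.
rewrite Rintegral_itv_bndo_bndc; last first.
  apply: (@integrableS _ _ _ mu `[k - 2^-1, k + 2^-1]) => //.
    by move=> x /=; rewrite !in_itv/= => /andP[-> /ltW ->].
  by apply: continuous_compact_integrable; [exact: segment_compact|exact: continuous_subspaceT].
rewrite /Rintegral (@continuous_FTC2 _ _ F)//.
- by rewrite /F/=; field.
- exact: continuous_subspaceT.
- split; last 2 first.
  + by apply: cvg_at_right_filter; exact: cF.
  + by apply: cvg_at_left_filter; exact: cF.
  by move=> x _; case: (dF x).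
- by move=> x _; rewrite derive1E; apply: derive_val.
Qed.

(* Jensen's inequality on the cell of [k], by the tangent line of [expR] at [k]. *)
Lemma gauss_le_cell m v (k : int) : 0 < v ->
  ((gauss m v k%:~R)%:E <=
   (expR (8 * v)^-1)%:E * \int[mu]_(x in `[(k%:~R - 2^-1)%R, (k%:~R + 2^-1)%R[) (gauss m v x)%:E)%E.
Proof.
move=> v0; have vn0 : v != 0 by rewrite gt_eqF.
pose C : set R := `[(k%:~R : R) - 2^-1, k%:~R + 2^-1[%classic.
have mC : measurable C by exact: measurable_itv.
have ig : mu.-integrable C (EFin \o gauss m v).
  apply: (@integrableS _ _ R mu [set: R] C _ _ _ _ (integrable_gauss m v0)) => //.
pose c := (k%:~R - m) / v.
have cf : continuous (fun x : R => 1 - (x - k%:~R) * c).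
  move=> x; apply: cvgB; first exact: cvg_cst.
  by apply: cvgMl; apply: cvgB; [exact: cvg_id|exact: cvg_cst].
have il : mu.-integrable C (EFin \o (fun x => 1 - (x - k%:~R) * c)).
  apply: (@integrableS _ _ _ mu `[(k%:~R : R) - 2^-1, k%:~R + 2^-1]) => //.
    by move=> x; rewrite /C/= !in_itv/= => /andP[-> /ltW ->].
  by apply: continuous_compact_integrable; [exact: segment_compact|exact: continuous_subspaceT].
(* On a cell of half-width [2^-1], [(x - k) ^+ 2 / (2 * v)] is at most [(8 * v)^-1]; this is the
   loss from dropping the quadratic term of the exponent. *)
pose A := expR (- (8 * v)^-1) * gauss m v k%:~R.
have il' : mu.-integrable C (EFin \o (fun x => A * (1 - (x - k%:~R) * c))).
  exact: (integrableZl _ A il).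
have : \int[mu]_(x in C) (A * (1 - (x - k%:~R) * c)) <= \int[mu]_(x in C) gauss m v x.
  apply: le_Rintegral => // x; rewrite /C/= in_itv/= => /andP[x1 x2].
  have -> : gauss m v x = A * expR (- (x - k%:~R) * c + ((8 * v)^-1 - (x - k%:~R) ^+ 2 / (2 * v))).
    by rewrite /A /gauss -!expRD; congr expR; rewrite /c; field.
  rewrite ler_wpM2l ?mulr_ge0 ?expR_ge0// (le_trans _ (expR_ge1Dx _))//.
  rewrite mulNr lerD2l lerDl subr_ge0.
  rewrite ler_pdivrMr ?mulr_gt0// (_ : _^-1 * _ = 4^-1); last by field.
  have : `|x - k%:~R| <= 2^-1 by rewrite ler_norml; lra.
  rewrite -ler_sqr ?nnegrE// real_normK ?num_real// expr2; lra.
rewrite RintegralZl// integral_affine_cell mulr1 -lee_fin.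
rewrite /Rintegral fineK; last exact: integrable_fin_num.
rewrite /A EFinM expRN => h.
have e0 : (0 <= (expR (8 * v)^-1)%:E)%E by rewrite lee_fin expR_ge0.
have := lee_wpmul2l e0 h.
have en : expR (8 * v)^-1 != 0 by rewrite gt_eqF// expR_gt0.
by rewrite muleA -EFinM divff// mul1r.
Qed.

(** The factor [expR (8 * v)^-1] tends to [1] as [v] grows, so this crude comparison with the
    integral is already sharp enough for the upper bound, with no need for Poisson summation. *)
Lemma gauss_sum_le m v : 0 < v ->
  (\esum_(k in [set: int]) (gauss m v k%:~R)%:E <=
   (expR (8 * v)^-1 * Num.sqrt (2 * pi * v))%:E)%E.
Proof.
move=> v0; rewrite EFinM -(integral_gauss m v0).
(* The floor of [x + 2^-1] rounds to the nearest integer, which cuts the line into the centred cells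
   of [gauss_le_cell]. *)
rewrite (@integral_int_partition _ _ _ mu (fun x => Num.floor (x * 1 + 2^-1)))//; last 3 first.
- by move=> k; exact: measurable_floor_preimage.
- by apply/measurable_EFinP; exact: measurable_gauss.
- by move=> x; rewrite lee_fin gauss_ge0.
rewrite esum_int; last by move=> k; rewrite lee_fin gauss_ge0.
rewrite esum_int; last first.
  by move=> k; apply: integral_ge0 => x _; rewrite lee_fin gauss_ge0.
rewrite -nneseriesZl//; last first.
  by move=> n _; apply: integral_ge0 => x _; rewrite lee_fin gauss_ge0.
apply: lee_nneseries => // n _; first by rewrite lee_fin gauss_ge0.
rewrite floor_preimage// !divr1.
rewrite (_ : (int_of_nat n)%:~R + 1 - 2^-1 = (int_of_nat n)%:~R + 2^-1); last by field.
exact: gauss_le_cell.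
Qed.

End gaussian_sum.

Lemma esum_intZl (R : realType) (c : R) (F : int -> R) : 0 <= c -> (forall k, 0 <= F k) ->
  (\esum_(k in [set: int]) (c * F k)%:E = c%:E * \esum_(k in [set: int]) (F k)%:E)%E.
Proof.
move=> c0 F0; rewrite !esum_int; [|by move=> k; rewrite lee_fin..|].
  by rewrite -nneseriesZl//; move=> n _; rewrite lee_fin.
by move=> k; rewrite lee_fin mulr_ge0.
Qed.

(** * The walk and the entropy upper bound *)

Section walk.
Context d (T : measurableType d) (R : realType) (P : probability T R) (K : T -> int).
Hypothesis mK : forall k, measurable (K @^-1` [set k]).

(** The law of a sum of [n] independent copies of [K], by conditioning on one step. Only the law of
    the single variable [K] enters; independence of the actual variables is used later, in
    [partial_sum_walk]. *)
Fixpoint walk (n : nat) (k : int) : R :=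
  if n is m.+1 then \int[P]_x walk m (k - K x) else (k == 0)%:R.

Lemma measurable_walk n k : measurable_fun setT (fun x => walk n (k - K x)).
Proof. exact: (measurable_fun_int mK (fun j => walk n (k - j))). Qed.

Lemma walk_itv n k : 0 <= walk n k <= 1.
Proof.
elim: n k => [|n IH] k /=; first by case: eqP; rewrite ?lexx ?ler01.
apply/andP; split; first by apply: Rintegral_ge0 => x _; have /andP[] := IH (k - K x).
rewrite -[leRHS](_ : \int[P]_x (cst 1 x) = 1); last first.
  by rewrite Rintegral_cst//= mul1r probability_setT.
have i1 : P.-integrable setT (EFin \o (cst (1 : R))).
  exact: finite_measure_integrable_cst.
apply: le_Rintegral => //; last by move=> x _; have /andP[] := IH (k - K x).
apply: le_integrable_EFin i1; first exact: measurable_walk.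
by move=> x; have /andP[h0 h1] := IH (k - K x); rewrite ger0_norm.
Qed.

Lemma walk_ge0 n k : 0 <= walk n k. Proof. by have /andP[] := walk_itv n k. Qed.

Lemma walk_le1 n k : walk n k <= 1. Proof. by have /andP[] := walk_itv n k. Qed.

Lemma integrable_walk n k : P.-integrable setT (EFin \o (fun x => walk n (k - K x))).
Proof.
apply: le_integrable_EFin (finite_measure_integrable_cst _ 1 measurableT).
  exact: measurable_walk.
by move=> x /=; rewrite ger0_norm ?walk_ge0// walk_le1.
Qed.

Lemma walkS n k : ((walk n.+1 k)%:E = \int[P]_x (walk n (k - K x))%:E)%E.
Proof. by rewrite /= fineK//; apply: integrable_fin_num => //; exact: integrable_walk. Qed.

Lemma esum_walk0 (g : int -> R) : (0 <= g 0) ->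
  (\esum_(k in [set: int]) (walk 0 k * g k)%:E = (g 0)%:E)%E.
Proof.
move=> g0; rewrite (esumID [set 0]) => [|k _].
  rewrite setTI esum_set1/= ?mul1r// setTI esum1 ?adde0// => k /eqP/negbTE/= ->.
  by rewrite mul0r.
by rewrite /=; case: eqP => [->|_]; rewrite ?mul1r ?mul0r// lee_fin.
Qed.

(** Tonelli's theorem and the shift [k -> k + K x] move the last step into the argument of [g]; mass
    and second moment then follow by induction. *)
Lemma esum_walkS n (g : int -> R) : (forall k, 0 <= g k) ->
  (\esum_(k in [set: int]) (walk n.+1 k * g k)%:E =
   \int[P]_x \esum_(k in [set: int]) (walk n k * g (k + K x)%R)%:E)%E.
Proof.
move=> g0.
transitivity (\esum_(k in [set: int]) \int[P]_x (walk n (k - K x) * g k)%:E)%E.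
  apply: eq_esum => k _; rewrite EFinM walkS -ge0_integralZr//.
  - by apply/measurable_EFinP; exact: measurable_walk.
  - by move=> x _; rewrite lee_fin walk_ge0.
  - by rewrite lee_fin.
rewrite -(integral_esum_int P (f := fun k x => (walk n (k - K x) * g k)%:E)).
- apply: eq_integral => x _; rewrite (esum_int_shift _ (K x)).
  by apply: eq_esum => k _; rewrite addrK.
- move=> k; apply/measurable_EFinP; apply: measurable_funM => //.
  exact: measurable_walk.
- by move=> k x; rewrite lee_fin mulr_ge0 ?walk_ge0.
Qed.

Lemma esum_walk n : (\esum_(k in [set: int]) (walk n k)%:E = 1)%E.
Proof.
elim: n => [|n IH].
  by under eq_esum do rewrite -[walk 0 _]mulr1; rewrite (@esum_walk0 (fun=> 1)).
under eq_esum do rewrite -[walk _ _]mulr1; rewrite (@esum_walkS n (fun=> 1))//.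
under eq_integral do under eq_esum do rewrite mulr1.
under eq_integral do rewrite IH.
by rewrite integral_cst//= mul1e probability_setT.
Qed.

(** The free shift [c] makes the induction close: one more step replaces [c] by [K x - m + c]. *)
Lemma esum_walk_sqr (m v : R) :
  (forall c : R, \int[P]_x (((K x)%:~R - m + c) ^+ 2)%:E = (v + c ^+ 2)%:E)%E ->
  forall n (c : R), (\esum_(k in [set: int])
    (walk n k * (k%:~R - n%:R * m + c) ^+ 2)%:E = (n%:R * v + c ^+ 2)%:E)%E.
Proof.
move=> hK; elim=> [|n IH] c.
  by rewrite (@esum_walk0 (fun k => (k%:~R - 0 * m + c) ^+ 2)) ?sqr_ge0// !mul0r subr0 !add0r.
rewrite (@esum_walkS n (fun k => (k%:~R - n.+1%:R * m + c) ^+ 2)) => [|k]; last exact: sqr_ge0.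
transitivity (\int[P]_x ((n%:R * v)%:E + (((K x)%:~R - m + c) ^+ 2)%:E))%E.
  apply: eq_integral => x _; rewrite -EFinD -IH; apply: eq_esum => k _.
  by rewrite intrD -[n.+1]addn1 natrD; congr (_ * _ ^+ 2)%:E; ring.
have mK2 : measurable_fun setT (fun x => (((K x)%:~R - m + c) ^+ 2)%:E).
  exact: (measurable_fun_int mK (fun k => ((k%:~R - m + c) ^+ 2)%:E)).
have v0 : 0 <= v.
  have := hK 0; rewrite expr0n/= addr0 => hK0; rewrite -lee_fin -hK0.
  by apply: integral_ge0 => x _; rewrite lee_fin sqr_ge0.
rewrite ge0_integralD//; last 2 first.
- by move=> x _; rewrite lee_fin mulr_ge0.
- by move=> x _; rewrite lee_fin sqr_ge0.
rewrite (integral_cst _ _ (n%:R * v)%:E)//= probability_setT mule1 hK -EFinD; congr (_%:E).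
by rewrite -[n.+1]addn1 natrD; ring.
Qed.

Definition walk_entropy n : \bar R :=
  \esum_(k in [set: int]) (- (walk n k * ln (walk n k)))%:E.

(* [Z] bounds the sum over the integers of the Gaussian with the mean and variance of the
   walk. *)
Lemma walk_entropy_le (m v : R) n (w := n%:R * v) (Z := expR (8 * w)^-1 * Num.sqrt (2 * pi * w)) :
  (forall c : R, \int[P]_x (((K x)%:~R - m + c) ^+ 2)%:E = (v + c ^+ 2)%:E)%E ->
  0 < w -> 1 <= Z -> (walk_entropy n <= (ln Z + 2^-1)%:E)%E.
Proof.
move=> hK w0 Z1.
have Z0 : 0 < Z by rewrite (lt_le_trans _ Z1).
have lnZ0 : 0 <= ln Z by rewrite ln_ge0.
pose b := n%:R * m.
(* Gibbs' inequality termwise, [- p ln p + p <= - p ln q + q], where [q] is the Gaussian divided by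
   [Z]. Subtraction of sums is avoided: the terms [p] sum to [1], the terms [q] to at most [1], and
   [1 <= Z] makes each summand on the right nonnegative. The [+ 0] matches [esum_walk_sqr]. *)
have key k : - (walk n k * ln (walk n k)) + walk n k <=
    walk n k * ln Z + (2 * w)^-1 * (walk n k * (k%:~R - b + 0) ^+ 2) + Z^-1 * gauss b w k%:~R.
  have := walk_ge0 n k; rewrite le_eqVlt => /orP[/eqP <-|p0].
    by rewrite !(mul0r, mulr0, oppr0, add0r)// mulr_ge0 ?gauss_ge0// invr_ge0 ltW.
  set p := walk n k in p0 *; set q := Z^-1 * gauss b w k%:~R.
  have q0 : 0 < q by rewrite mulr_gt0 ?gauss_gt0// invr_gt0.
  have lnq : ln q = - ln Z - (2 * w)^-1 * (k%:~R - b + 0) ^+ 2.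
    rewrite /q lnM ?posrE ?gauss_gt0 ?invr_gt0// lnV ?posrE// /gauss expRK addr0.
    by rewrite mulrC.
  have : ln (q / p) <= q / p - 1 by rewrite -{1}(subrKC 1 (q / p)) le_ln1Dx// ltrBrDl subrr divr_gt0.
  rewrite ln_div ?posrE// => h.
  have := ler_wpM2l (ltW p0) h.
  rewrite (_ : p * (q / p - 1) = q - p); last by field; rewrite gt_eqF.
  rewrite lnq; set s := _ ^+ 2; set a := (2 * w)^-1; set l := ln Z; set l' := ln p; nra.
have : (walk_entropy n + 1 <= ((ln Z)%:E + 2^-1%:E) + 1)%E.
  rewrite -[X in (_ + X <= _)%E](esum_walk n) /walk_entropy -esumD; last 2 first.
  - move=> k _; rewrite lee_fin -mulrN mulr_ge0 ?walk_ge0// oppr_ge0 ln_le0//.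
    exact: walk_le1.
  - by move=> k _; rewrite lee_fin walk_ge0.
  under eq_esum do rewrite -EFinD.
  apply: (@le_trans _ _ (\esum_(k in [set: int]) ((walk n k * ln Z)%:E +
      ((2 * w)^-1 * (walk n k * (k%:~R - b + 0) ^+ 2))%:E + (Z^-1 * gauss b w k%:~R)%:E)))%E.
    by apply: le_esum => k _; rewrite -!EFinD lee_fin; exact: key.
  have iw0 : 0 <= (2 * w)^-1 by rewrite invr_ge0 mulr_ge0// ltW.
  have n1 k : (0 <= (walk n k * ln Z)%:E)%E by rewrite lee_fin mulr_ge0 ?walk_ge0.
  have n2 k : (0 <= ((2 * w)^-1 * (walk n k * (k%:~R - b + 0) ^+ 2))%:E)%E.
    by rewrite lee_fin mulr_ge0// mulr_ge0 ?walk_ge0 ?sqr_ge0.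
  have n3 k : (0 <= (Z^-1 * gauss b w k%:~R)%:E)%E.
    by rewrite lee_fin mulr_ge0 ?gauss_ge0// invr_ge0 ltW.
  rewrite !esumD//; last by move=> k _; rewrite adde_ge0.
  apply: leeD; first apply: leeD.
  - under eq_esum do rewrite mulrC.
    by rewrite esum_intZl ?esum_walk ?mule1// => k; rewrite walk_ge0.
  - rewrite esum_intZl ?(esum_walk_sqr hK)//; last first.
      by move=> k; rewrite mulr_ge0 ?walk_ge0 ?sqr_ge0.
    rewrite expr0n/= addr0 -EFinM lee_fin invfM -mulrA mulVf ?mulr1// gt_eqF//.
  - rewrite esum_intZl ?invr_ge0 ?(ltW Z0)//; last by move=> k; rewrite gauss_ge0.
    have Z10 : (0 <= Z^-1%:E)%E by rewrite lee_fin invr_ge0 ltW.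
    apply: (le_trans (lee_wpmul2l Z10 (gauss_sum_le b w0))).
    by rewrite -EFinM lee_fin -/Z mulVf// gt_eqF.
by rewrite leeD2rE// EFinD.
Qed.

End walk.

(** * Decay of the characteristic function *)

Section characteristic_function.
Context d (T : measurableType d) (R : realType) (P : probability T R) (K : T -> int).
Hypothesis mK : forall k, measurable (K @^-1` [set k]).
Variables (m v : R).
Hypothesis hK : forall c : R,
  (\int[P]_x (((K x)%:~R - m + c) ^+ 2)%:E = (v + c ^+ 2)%:E)%E.

Implicit Types (t c a : R).

Let Y x : R := (K x)%:~R - m.

Let mY : measurable_fun setT Y.
Proof. exact: (measurable_fun_int mK (fun k => k%:~R - m)). Qed.

Lemma integrable_bounded (f : T -> R) c : measurable_fun setT f ->
  (forall x, `|f x| <= c) -> P.-integrable setT (EFin \o f).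
Proof.
move=> mf fc; apply: le_integrable_EFin (finite_measure_integrable_cst _ c measurableT) => //.
Qed.

Let intY2 : (\int[P]_x (Y x ^+ 2)%:E = v%:E)%E.
Proof.
have := hK 0; rewrite expr0n/= addr0 => <-.
by apply: eq_integral => x _; rewrite addr0.
Qed.

Let iY2 : P.-integrable setT (EFin \o (fun x => Y x ^+ 2)).
Proof.
apply/integrableP; split; first by apply/measurable_EFinP; mfun.
rewrite (_ : (\int[P]_x _)%E = v%:E) ?ltry// -intY2.
by apply: eq_integral => x _; rewrite /= ger0_norm// sqr_ge0.
Qed.

Lemma Rintegral_sqr : \int[P]_x (Y x ^+ 2) = v.
Proof. by rewrite /Rintegral intY2. Qed.

Let iY : P.-integrable setT (EFin \o Y).
Proof.
have i1 : P.-integrable setT (EFin \o (cst (1 : R))) by exact: finite_measure_integrable_cst.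
apply: le_integrable_EFin (integrable_EFinD i1 iY2) => // x /=.
by rewrite -real_normK ?num_real//; have := sqr_ge0 (`|Y x| - 2^-1); lra.
Qed.

Lemma integrable_sqr : P.-integrable setT (EFin \o (fun x => ((K x)%:~R - m) ^+ 2)).
Proof. exact: iY2. Qed.

Lemma integrable_centered : P.-integrable setT (EFin \o (fun x => (K x)%:~R - m)).
Proof. exact: iY. Qed.

(** Expanding [hK] at [c = 1] and subtracting the second moment leaves [2 * E Y = 0]. *)
Lemma Rintegral_centered : \int[P]_x Y x = 0.
Proof.
have i1 : P.-integrable setT (EFin \o (cst (1 : R))) by exact: finite_measure_integrable_cst.
have : \int[P]_x (Y x ^+ 2 + (2 * Y x + cst 1 x)) = v + 1.
  transitivity (\int[P]_x ((Y x + 1) ^+ 2)).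
    by apply: eq_Rintegral => x _; rewrite /cst; ring.
  by rewrite /Rintegral; have := hK 1; rewrite expr1n => ->.
rewrite RintegralD//; last by apply: integrable_EFinD => //; exact: integrable_EFinZl.
rewrite RintegralD//; last exact: integrable_EFinZl.
rewrite RintegralZl// Rintegral_sqr Rintegral_cst//= mul1r probability_setT/=.
lra.
Qed.

(** [recf] and [imcf] are the real and imaginary parts of the characteristic function of the centred
    step. *)
Definition recf t : R := \int[P]_x cos (t * Y x).
Definition imcf t : R := \int[P]_x sin (t * Y x).

Let icos (f : T -> R) : measurable_fun setT f -> P.-integrable setT (EFin \o (fun x => cos (f x))).
Proof. by move=> mf; apply: (integrable_bounded (c := 1)); [mfun|move=> x; exact: cos_max]. Qed.

Let isin (f : T -> R) : measurable_fun setT f -> P.-integrable setT (EFin \o (fun x => sin (f x))).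
Proof. by move=> mf; apply: (integrable_bounded (c := 1)); [mfun|move=> x; exact: sin_max]. Qed.

Let mtY t : measurable_fun setT (fun x => t * Y x).
Proof. by mfun. Qed.

Lemma continuous_recf : continuous recf.
Proof.
move=> t; have It : t \in (`]t - 1, t + 1[ : set R)%classic.
  by rewrite inE /= in_itv/=; apply/andP; split; lra.
apply: (@continuity_under_integral _ _ _ P (fun t x => cos (t * Y x)) setT measurableT
  (t - 1) (t + 1) _ _ (cst 1) _ _ _ It).
- by move=> x _; exact: icos.
- by apply: aeW => x _ y _; exact: continuous_cosM.
- exact: finite_measure_integrable_cst.
- by move=> x _; apply: aeW => y _; exact: cos_max.
Qed.

Lemma continuous_imcf : continuous imcf.
Proof.
move=> t; have It : t \in (`]t - 1, t + 1[ : set R)%classic.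
  by rewrite inE /= in_itv/=; apply/andP; split; lra.
apply: (@continuity_under_integral _ _ _ P (fun t x => sin (t * Y x)) setT measurableT
  (t - 1) (t + 1) _ _ (cst 1) _ _ _ It).
- by move=> x _; exact: isin.
- by apply: aeW => x _ y _; exact: continuous_sinM.
- exact: finite_measure_integrable_cst.
- by move=> x _; apply: aeW => y _; exact: sin_max.
Qed.

Lemma recf_imcf_rot t a : recf t * cos a + imcf t * sin a = \int[P]_x cos (t * Y x - a).
Proof.
under [RHS]eq_Rintegral do rewrite cosB.
rewrite RintegralD//; last 2 first.
- by apply: (integrable_bounded (c := 1)); [mfun|move=> x; rewrite normrM mulr_ile1// ?cos_max].
- by apply: (integrable_bounded (c := 1)); [mfun|move=> x; rewrite normrM mulr_ile1// ?sin_max].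
by rewrite !RintegralZr//; [exact: isin|exact: icos].
Qed.

(* [recf t ^+ 2 + imcf t ^+ 2] is the expectation of [cos] over two independent copies. *)
Lemma cf_norm_sym t : recf t ^+ 2 + imcf t ^+ 2 =
  \int[P]_y \int[P]_x cos (t * Y x - t * Y y).
Proof.
under eq_Rintegral do rewrite -recf_imcf_rot.
rewrite RintegralD//; last 2 first.
- by apply: integrable_EFinZl; exact: icos.
- by apply: integrable_EFinZl; exact: isin.
by rewrite !RintegralZl// ?expr2//; [exact: isin|exact: icos].
Qed.

Lemma Rintegral_le1 (f : T -> R) : measurable_fun setT f -> (forall x, `|f x| <= 1) ->
  \int[P]_x f x <= 1.
Proof.
move=> mf f1; rewrite -[leRHS](_ : \int[P]_x (cst 1 x) = 1); last first.
  by rewrite Rintegral_cst//= mul1r probability_setT.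
apply: le_Rintegral => //.
- exact: integrable_bounded f1.
- exact: finite_measure_integrable_cst.
- by move=> x _; rewrite (le_trans _ (f1 x))// ler_norm.
Qed.

Let mcfrot t : measurable_fun setT (fun y => \int[P]_x cos (t * Y x - t * Y y)).
Proof. by under eq_fun do rewrite -recf_imcf_rot; mfun. Qed.

Let cfrot_norm t y : `|\int[P]_x cos (t * Y x - t * Y y)| <= 1.
Proof.
have mc : measurable_fun setT (fun x => t * Y x - t * Y y) by mfun.
rewrite (le_trans (le_normr_Rintegral _ (icos mc)))//.
by apply: Rintegral_le1; [mfun|move=> x; rewrite normr_id cos_max].
Qed.

Lemma cf_norm_le1 t : recf t ^+ 2 + imcf t ^+ 2 <= 1.
Proof. by rewrite cf_norm_sym; apply: Rintegral_le1. Qed.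

(** Half the mean of [1 - cos ((K - j0) t)]: it measures how far [exp (i t (K - j0))] is from
    [1]. *)
Definition sindev (j0 : int) t : R := \int[P]_x (sin ((K x - j0)%:~R * (t / 2)) ^+ 2).

Let msindev (j : int) t : measurable_fun setT (fun x => sin ((K x - j)%:~R * (t / 2)) ^+ 2).
Proof. exact: (measurable_fun_int mK (fun k => sin ((k - j)%:~R * (t / 2)) ^+ 2)). Qed.

Lemma le_atom (F : int -> R) (j : int) : (forall k, 0 <= F k) ->
  P.-integrable setT (EFin \o (F \o K)) ->
  F j * fine (P (K @^-1` [set j])) <= \int[P]_x F (K x).
Proof.
move=> F0 iF.
have iFj : P.-integrable (K @^-1` [set j]) (EFin \o (F \o K)).
  exact: (integrableS measurableT).
rewrite -Rintegral_cst// -lee_fin /Rintegral !fineK//; last 2 first.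
- exact: integrable_fin_num.
- by apply: integrable_fin_num => //; exact: finite_measure_integrable_cst.
rewrite (@eq_integral _ _ _ P (K @^-1` [set j]) (fun x => (F (K x))%:E)); last first.
  by move=> x; rewrite inE => /= ->.
apply: ge0_subset_integral => //.
- exact: (measurable_fun_int mK (fun k => (F k)%:E)).
- by move=> x _; rewrite lee_fin.
Qed.

Lemma Rintegral_onem (f : T -> R) : P.-integrable setT (EFin \o f) ->
  \int[P]_x (1 - f x) = 1 - \int[P]_x f x.
Proof.
move=> intf; rewrite (@RintegralB _ _ _ P setT (cst 1) f)//.
  by rewrite Rintegral_cst//= mul1r probability_setT.
exact: finite_measure_integrable_cst.
Qed.

(** By symmetrisation, [1 - |phi t|^2] is the mean of [1 - cos (t (K - K'))] over two independent
    copies. Keeping only the event [K' = j0] leaves [p0] times twice [sindev j0 t]. *)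
Lemma cf_norm_sindev (j0 : int) t (p0 := fine (P (K @^-1` [set j0]))) :
  2 * p0 * sindev j0 t <= 1 - (recf t ^+ 2 + imcf t ^+ 2).
Proof.
pose F (k : int) := 1 - \int[P]_x cos (t * Y x - t * (k%:~R - m)).
have F0 k : 0 <= F k.
  rewrite subr_ge0; apply: Rintegral_le1; first by mfun.
  by move=> x; exact: cos_max.
have iFK : P.-integrable setT (EFin \o (fun y => \int[P]_x cos (t * Y x - t * Y y))).
  exact: integrable_bounded (cfrot_norm t).
have i1 : P.-integrable setT (EFin \o (cst (1 : R))) by exact: finite_measure_integrable_cst.
have -> : 1 - (recf t ^+ 2 + imcf t ^+ 2) = \int[P]_y F (K y).
  by rewrite cf_norm_sym /F Rintegral_onem.
apply: le_trans (le_atom j0 F0 _); last exact: (integrable_EFinB i1 iFK).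
rewrite mulrC mulrA ler_wpM2r ?fine_ge0//.
have i2 : P.-integrable setT (EFin \o (fun x => cos (t * Y x - t * (j0%:~R - m)))).
  by apply: icos; mfun.
rewrite /F -Rintegral_onem// mulrC -RintegralZl//; last first.
  apply: (integrable_bounded (c := 1)) => // x.
  by rewrite normrX expr_le1//; exact: sin_max.
rewrite le_eqVlt; apply/orP; left; apply/eqP; apply: eq_Rintegral => x _.
rewrite onem_cosE; congr (2 * sin _ ^+ 2).
by rewrite /Y intrB; field.
Qed.

(* The case [n = 0], where divisibility means equality, excludes a constant [K]. *)
Definition aperiodic : Prop := exists2 j0 : int, (0 < P (K @^-1` [set j0]))%E &
  forall n : nat, (forall k, (0 < P (K @^-1` [set k]))%E -> (n%:Z %| k - j0)%Z) -> n = 1%N.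

Lemma fine_atom_gt0 j : (0 < P (K @^-1` [set j]))%E -> 0 < fine (P (K @^-1` [set j])).
Proof.
move=> pj; apply: fine_gt0; rewrite pj/=.
by rewrite (le_lt_trans (probability_le1 _ _))// ltry.
Qed.

Let isindev (j : int) t : P.-integrable setT (EFin \o (fun x => sin ((K x - j)%:~R * (t / 2)) ^+ 2)).
Proof.
apply: (integrable_bounded (c := 1)) => // x.
by rewrite normrX expr_le1//; exact: sin_max.
Qed.

(* The integers [j] with [sin (j t / 2) ^+ 2 <= C * sindev j0 t] for all [t] form a
   subgroup containing the differences of atoms, hence all of [int]. *)
Lemma cf_decay : aperiodic -> exists2 w : R, 0 < w &
  forall t, `|t| <= pi -> recf t ^+ 2 + imcf t ^+ 2 <= gauss 0 w t ^+ 2.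
Proof.
move=> [j0 p0 gcd1].
pose G (j : int) := exists2 C : R, 0 <= C &
  forall t, sin (j%:~R * (t / 2)) ^+ 2 <= C * sindev j0 t.
have GB i j : G i -> G j -> G (i - j).
  move=> [C C0 hC] [D D0 hD]; exists (2 * C + 2 * D).
    by rewrite addr_ge0// mulr_ge0.
  move=> t; rewrite intrB mulrBl (le_trans (sqr_sinD_le _ _))// sinN sqrrN.
  have := hC t; have := hD t; lra.
have Gatom k : (0 < P (K @^-1` [set k]))%E -> G (k - j0).
  move=> pk; have pk' := fine_atom_gt0 pk.
  (* [sindev j0 t] is at least the contribution of the atom [k], so the inverse weight of that atom
     is a valid constant. *)
  exists (fine (P (K @^-1` [set k])))^-1; first by rewrite invr_ge0 ltW.
  move=> t; rewrite -ler_pdivrMl ?invr_gt0// invrK mulrC.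
  apply: (le_atom (F := fun k => sin ((k - j0)%:~R * (t / 2)) ^+ 2)).
    by move=> ?; exact: sqr_ge0.
  exact: isindev.
have [n [C C0 hC] Gn] := int_subgroup_gen GB (Gatom _ p0).
have n1 : n = 1%N by apply: gcd1 => k /Gatom /Gn.
have p0' := fine_atom_gt0 p0; set p := fine _ in p0'.
(* From [t^2 / 16 <= sin (t / 2)^2 <= C * sindev j0 t] and [2 * p * sindev j0 t <= 1 - |phi t|^2];
   using [C + 1] in place of [C] keeps [w] positive. *)
pose w := 8 * (C + 1) / p.
have C1 : 0 < C + 1 by rewrite ltr_wpDl.
have w0 : 0 < w by rewrite divr_gt0// mulr_gt0.
exists w => // t tpi.
have s0 : 0 <= sindev j0 t by apply: Rintegral_ge0 => x _; exact: sqr_ge0.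
have h1 := sqr_sin_half_ge tpi.
have h2 := hC t; rewrite n1 mul1r in h2.
have h3 : 2 * p * sindev j0 t <= 1 - (recf t ^+ 2 + imcf t ^+ 2) := cf_norm_sindev j0 t.
have h4 : t ^+ 2 / w <= 2 * p * sindev j0 t.
  rewrite ler_pdivrMr// /w.
  have -> : 2 * p * sindev j0 t * (8 * (C + 1) / p) = 16 * ((C + 1) * sindev j0 t).
    by field; rewrite gt_eqF.
  have : C * sindev j0 t <= (C + 1) * sindev j0 t by rewrite ler_wpM2r// lerDl.
  lra.
apply: (@le_trans _ _ (1 + - (t ^+ 2 / w))); first lra.
rewrite (le_trans (expR_ge1Dx _))// /gauss subr0 -expRM_natl.
by rewrite (_ : - (t ^+ 2 / w) = 2 * - (t ^+ 2 / (2 * w)))//; field; rewrite gt_eqF.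
Qed.

(** With zero variance every atom would sit at [m], so [0] would divide all differences and
    aperiodicity would give [0 = 1]. *)
Lemma aperiodic_var_gt0 : aperiodic -> 0 < v.
Proof.
move=> [j0 p0 gcd1].
have v0 : 0 <= v by rewrite -Rintegral_sqr; apply: Rintegral_ge0 => x _; exact: sqr_ge0.
rewrite lt_neqAle v0 andbT; apply/eqP => v0'.
have atom k : (0 < P (K @^-1` [set k]))%E -> k%:~R = m.
  move=> /fine_atom_gt0 pk; apply/eqP; rewrite -subr_eq0 -sqrf_eq0 eq_le sqr_ge0 andbT.
  rewrite -(pmulr_lle0 _ pk).
  have := @le_atom (fun k => (k%:~R - m) ^+ 2) k (fun _ => sqr_ge0 _) iY2.
  by rewrite Rintegral_sqr -v0'.
have /gcd1 // : forall k, (0 < P (K @^-1` [set k]))%E -> (0%N%:Z %| k - j0)%Z.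
by move=> k pk; rewrite dvd0z subr_eq0 -(eqr_int R) (atom _ pk) (atom _ p0).
Qed.

End characteristic_function.

Lemma measurable_bounded_Rintegrable d (T : measurableType d) (R : realType)
    (mu : {measure set T -> \bar R}) (D : set T) (f : T -> R) (c : R) :
  measurable D -> (mu D < +oo)%E -> measurable_fun D f -> (forall x, D x -> `|f x| <= c) ->
  mu.-integrable D (EFin \o f).
Proof.
move=> mD muD mf fc; apply: measurable_bounded_integrable => //.
exists `|c|; split; first exact: num_real.
by move=> M cM x Dx /=; rewrite (le_trans (fc x Dx))// (le_trans (ler_norm _))// ltW.
Qed.

(** * The local limit theorem *)

Section fubini_bounded.
Context d (T : measurableType d) (R : realType) (P : probability T R).
Notation mu := (@lebesgue_measure R).

Lemma Rfubini_bounded (h : T -> R -> R) (a b c : R) :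
  measurable_fun [set: T * R] (fun z => h z.1 z.2) -> (forall x u, `|h x u| <= c) ->
  \int[P]_x \int[mu]_(u in `[a, b]) h x u = \int[mu]_(u in `[a, b]) \int[P]_x h x u.
Proof.
move=> mh hc; set D := `[a, b]%classic.
have mD : measurable D by exact: measurable_itv.
have c0 : 0 <= c by rewrite (le_trans _ (hc point 0)).
have muD : (mu D < +oo)%E.
  by rewrite /D lebesgue_measure_itv/=; case: ifP => _; rewrite ?ltry// -EFinB ltry.
have mh1 x : measurable_fun [set: R] (h x) by exact: (measurableT_comp mh (measurable_pair1 x)).
have mh2 u : measurable_fun [set: T] (h ^~ u) by exact: (measurableT_comp mh (measurable_pair2 u)).
(* The indicator moves the interval into the integrand, so that Fubini applies on the full product;
   integrability holds because [f] is bounded and lives over a set of finite measure. *)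
pose f (z : T * R) := (\1_D z.2 * h z.1 z.2)%:E.
have mf : measurable_fun [set: T * R] f.
  apply/measurable_EFinP; apply: measurable_funM => //.
  apply: measurableT_comp; last exact: measurable_snd.
  exact: measurable_indic.
have int1 x : (\int[mu]_u f (x, u) = (\int[mu]_(u in D) h x u)%:E)%E.
  rewrite /Rintegral fineK; last first.
    apply: integrable_fin_num => //.
    apply: (@measurable_bounded_Rintegrable _ _ _ mu D _ c) => //.
    exact: (measurable_funS measurableT (@subsetT _ D) (mh1 x)).
  rewrite [RHS]integral_mkcond; apply: eq_integral => u _.
  by rewrite /f /= patchE indicE; case: ifPn => _; rewrite ?mul1r ?mul0r.
have int2 u : (\int[P]_x f (x, u) = (\1_D u * \int[P]_x h x u)%:E)%E.
  have ih : P.-integrable setT (EFin \o h ^~ u) by exact: (integrable_bounded P (c := c)).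
  rewrite EFinM /Rintegral fineK; last exact: integrable_fin_num.
  by rewrite /f -integralZl//.
have intf : (P \x mu)%E.-integrable setT f.
  apply/(@integrable12ltyP _ _ _ _ _ P mu f mf).
  apply: (@le_lt_trans _ _ (\int[P]_x (c%:E * mu D))%E); last first.
    rewrite integral_cst//= probability_setT mule1.
    by rewrite lte_mul_pinfty.
  apply: ge0_le_integral => //.
  - by move=> x _; exact: integral_ge0.
  - have mabs : measurable_fun [set: T * R] (abse \o f) by exact: measurableT_comp.
    exact: (@measurable_fun_fubini_tonelli_F _ _ _ _ _ mu (abse \o f) mabs (fun=> abse_ge0 _)).
  - move=> x _; rewrite -integral_cst// [leRHS]integral_mkcond.
    apply: ge0_le_integral => //.
    + by apply: measurableT_comp => //; exact: (measurableT_comp mf (measurable_pair1 x)).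
    + by apply/(measurable_restrictT _ _).1.
    + move=> u _; rewrite /f /= patchE indicE; case: ifPn => _.
        by rewrite mul1r lee_fin.
      by rewrite mul0r normr0.
have := @Fubini _ _ _ _ _ P mu f intf.
under eq_integral do rewrite int1.
under [in X in _ = X -> _]eq_integral do rewrite int2.
move=> E; rewrite {1}/Rintegral E [RHS]/Rintegral [in RHS]integral_mkcond; congr fine.
apply: eq_integral => u _; rewrite patchE indicE.
by case: ifPn => _; rewrite ?mul1r ?mul0r.
Qed.

End fubini_bounded.

Section local_limit.
Context d (T : measurableType d) (R : realType) (P : probability T R) (K : T -> int).
Hypothesis mK : forall k, measurable (K @^-1` [set k]).
Variables (m v : R).
Hypothesis hK : forall c : R,
  (\int[P]_x (((K x)%:~R - m + c) ^+ 2)%:E = (v + c ^+ 2)%:E)%E.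
Notation mu := (@lebesgue_measure R).
Implicit Types (t s u : R) (k : int).

Let Y x : R := (K x)%:~R - m.

Let mY : measurable_fun setT Y.
Proof. exact: (measurable_fun_int mK (fun k => k%:~R - m)). Qed.

Let re t := recf P K m t.
Let im t := imcf P K m t.

Lemma continuous_cpow n s : continuous (fun u => (cpow (re (u / s)) (im (u / s)) n).1) /\
  continuous (fun u => (cpow (re (u / s)) (im (u / s)) n).2).
Proof.
have cs u : (fun u => u / s) @ u --> u / s by apply: cvgMl; exact: cvg_id.
have cre : continuous (fun u => re (u / s)).
  by move=> u; apply: (@continuous_comp _ _ _ (fun u => u / s) re); [exact: cs|exact: continuous_recf].
have cim : continuous (fun u => im (u / s)).
  by move=> u; apply: (@continuous_comp _ _ _ (fun u => u / s) im); [exact: cs|exact: continuous_imcf].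
elim: n => [|n [IH1 IH2]] /=; first by split => u; exact: cvg_cst.
split => u.
- by apply: cvgB; apply: cvgM; [exact: IH1|exact: cre|exact: IH2|exact: cim].
- by apply: cvgD; apply: cvgM; [exact: IH1|exact: cim|exact: IH2|exact: cre].
Qed.

(* The integrand of the inversion formula at scale [s]: the real part of
   [phi (u / s) ^+ n * exp (- i (u / s) (k - n m))], with [phi] the characteristic function
   of the centered step. *)
Definition kernel n s (y : R) u :=
  (cpow (re (u / s)) (im (u / s)) n).1 * cos (u / s * y) +
  (cpow (re (u / s)) (im (u / s)) n).2 * sin (u / s * y).

Lemma kernel_norm n s y u : `|kernel n s y u| <= 2.
Proof.
have [A1 B1] := cpow_le1 n (cf_norm_le1 P mK m (u / s)).
rewrite (le_trans (ler_normD _ _))// -[2]/(1 + 1) !normrM lerD// mulr_ile1//.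
- exact: cos_max.
- exact: sin_max.
Qed.

Lemma sin_int_pi k : sin (k%:~R * pi) = 0 :> R.
Proof.
have nat_case (j : nat) : sin (j%:R * pi) = 0 :> R.
  elim: j => [|j IH]; first by rewrite mul0r sin0.
  by rewrite -[j.+1]addn1 natrD mulrDl mul1r sinDpi IH oppr0.
by case: k => j; rewrite ?NegzE ?mulrNz ?mulNr ?sinN nat_case ?oppr0.
Qed.

(** Inversion by induction on the number of steps. For [n = 0] it is the orthogonality of
    [cos (k t)] to constants over a period; a further step is averaged under the integral by Fubini
    and multiplies the integrand by [phi]. Building in the scale [s] makes a later change of
    variables unnecessary. *)
Lemma walk_fourier n s k : 0 < s ->
  2 * pi * s * walk P K n k =
  \int[mu]_(u in `[- (pi * s), pi * s]) kernel n s (k%:~R - n%:R * m) u.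
Proof.
move=> s0; have pi0 : 0 < pi :> R := pi_gt0 R.
have ps0 : 0 < pi * s by rewrite mulr_gt0.
have sn0 : s != 0 by rewrite gt_eqF.
elim: n k => [|n IH] k.
  have -> : \int[mu]_(u in `[- (pi * s), pi * s]) kernel 0 s (k%:~R - 0%:R * m) u =
      \int[mu]_(u in `[- (pi * s), pi * s]) cos (u / s * k%:~R).
    by apply: eq_Rintegral => u _; rewrite /kernel/= !mul0r subr0 mul1r addr0.
  rewrite /=.
  have [->|k0] := eqVneq k 0.
    under eq_Rintegral do rewrite mulr0 cos0.
    rewrite Rintegral_cst//= lebesgue_measure_itv/= lte_fin.
    rewrite ifT; last by lra.
    by rewrite -EFinB/=; ring.
  have kn0 : k%:~R != 0 :> R by rewrite intr_eq0.
  pose F u := s / k%:~R * sin (u / s * k%:~R).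
  have dF u : is_derive u (1 : R) F (cos (u / s * k%:~R)).
    by apply: is_derive_eq; rewrite /GRing.scale/=; field; rewrite ?kn0 ?sn0.
  have cF : continuous F.
    by move=> x; apply/differentiable_continuous/derivable1_diffP; case: (dF x).
  rewrite /Rintegral (@continuous_FTC2 _ _ F)//=; last 4 first.
  - by lra.
  - apply: continuous_subspaceT => u; apply: continuous_comp; last exact: continuous_cos.
    by apply: cvgMl; apply: cvgMl; exact: cvg_id.
  - split; last 2 first.
    + by apply: cvg_at_right_filter; exact: cF.
    + by apply: cvg_at_left_filter; exact: cF.
    by move=> x _; case: (dF x).
  - by move=> x _; rewrite derive1E; apply: derive_val.
  rewrite mulr0 /F.
  have -> : pi * s / s * k%:~R = k%:~R * pi by field.
  have -> : - (pi * s) / s * k%:~R = - (k%:~R * pi) by field.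
  by rewrite sinN !sin_int_pi oppr0 mulr0 subr0.
have [cA cB] := continuous_cpow n s.
transitivity (\int[P]_x (2 * pi * s * walk P K n (k - K x))).
  by rewrite RintegralZl//; exact: (integrable_walk P mK).
under eq_Rintegral do rewrite IH.
pose h x u := kernel n s ((k - K x)%:~R - n%:R * m) u.
have mh : measurable_fun [set: T * R] (fun z => h z.1 z.2).
  have m1 (w : R -> R) : measurable_fun [set: R] w ->
      measurable_fun [set: T * R] (fun z => w z.2).
    by move=> mw; apply: measurableT_comp => //; exact: measurable_snd.
  have mk : measurable_fun [set: T * R] (fun z => (k - K z.1)%:~R - n%:R * m : R).
    apply: (measurableT_comp (f := fun x => (k - K x)%:~R - n%:R * m : R)).
      exact: (measurable_fun_int mK (fun j => (k - j)%:~R - n%:R * m)).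
    exact: measurable_fst.
  have mA := m1 _ (continuous_measurable_fun cA).
  have mB := m1 _ (continuous_measurable_fun cB).
  have ms : measurable_fun [set: T * R] (fun z => z.2 / s).
    by apply: (m1 (fun u => u / s)); mfun.
  by rewrite /h /kernel; mfun.
rewrite (@Rfubini_bounded _ _ _ P h _ _ 2 mh); last by move=> x u; exact: kernel_norm.
apply: eq_Rintegral => u _; rewrite /h /kernel.
set A := (cpow _ _ n).1; set B := (cpow _ _ n).2; set t := u / s.
(* The phase after [n] steps is [a - t * Y x]; expanding it by the addition formulas reproduces the
   complex multiplication in [cpow]. *)
pose a := t * (k%:~R - n.+1%:R * m).
have -> : \int[P]_x (A * cos (t * ((k - K x)%:~R - n%:R * m)) +
    B * sin (t * ((k - K x)%:~R - n%:R * m))) =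
  \int[P]_x ((A * cos a + B * sin a) * cos (t * Y x) +
    (A * sin a - B * cos a) * sin (t * Y x)).
  apply: eq_Rintegral => x _.
  have -> : t * ((k - K x)%:~R - n%:R * m) = a - t * Y x.
    by rewrite /a /Y intrB -[n.+1]addn1 natrD; ring.
  by rewrite cosB sinB; ring.
have ic : P.-integrable setT (EFin \o (fun x => cos (t * Y x))).
  by apply: (integrable_bounded P (c := 1)); [mfun|move=> x; exact: cos_max].
have is_ : P.-integrable setT (EFin \o (fun x => sin (t * Y x))).
  by apply: (integrable_bounded P (c := 1)); [mfun|move=> x; exact: sin_max].
rewrite RintegralD//; [|exact: integrable_EFinZl..].
rewrite !RintegralZl// -/(recf P K m t) -/(imcf P K m t) -/(re t) -/(im t) /=.
by rewrite -/A -/B -/a; ring.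
Qed.

(* The exponent scales as [gauss 0 w (u / sqrt n) ^+ n = gauss 0 w u]. *)
Lemma gauss_sqrt_pow w n u : (0 < n)%N ->
  gauss 0 w (u / Num.sqrt n%:R) ^+ n = gauss 0 w u.
Proof.
move=> n0; rewrite /gauss !subr0 -expRM_natl; congr expR.
rewrite expr_div_n sqr_sqrtr// mulrN; congr (- _).
rewrite mulrAC mulrCA mulfV ?mulr1// pnatr_eq0 -lt0n//.
Qed.

Lemma measurable_kernel n s y : measurable_fun [set: R] (kernel n s y).
Proof.
have [/continuous_measurable_fun cA /continuous_measurable_fun cB] := continuous_cpow n s.
by rewrite /kernel; mfun.
Qed.

Lemma kernel_gauss_le w : 0 < w ->
  (forall t, `|t| <= pi -> re t ^+ 2 + im t ^+ 2 <= gauss 0 w t ^+ 2) ->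
  forall n y u, (0 < n)%N -> `|u| <= pi * Num.sqrt n%:R ->
  `|kernel n (Num.sqrt n%:R) y u| <= 2 * gauss 0 w u.
Proof.
move=> w0 decay n y u n0 un; set s := Num.sqrt n%:R.
have s0 : 0 < s by rewrite sqrtr_gt0 ltr0n.
have /decay : `|u / s| <= pi by rewrite normf_div (gtr0_norm s0) ler_pdivrMr.
set a := re _; set b := im _ => ab.
have : (a ^+ 2 + b ^+ 2) ^+ n <= gauss 0 w u ^+ 2.
  rewrite -(gauss_sqrt_pow w u n0) -/s -exprM mulnC exprM.
  by rewrite lerXn2r ?nnegrE ?addr_ge0 ?sqr_ge0.
rewrite -cpow_norm; set A := (cpow _ _ _).1; set B := (cpow _ _ _).2 => AB.
have hA : `|A| <= gauss 0 w u.
  rewrite -ler_sqr ?nnegrE ?gauss_ge0// real_normK ?num_real//.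
  by have := sqr_ge0 B; lra.
have hB : `|B| <= gauss 0 w u.
  rewrite -ler_sqr ?nnegrE ?gauss_ge0// real_normK ?num_real//.
  by have := sqr_ge0 A; lra.
rewrite (le_trans (ler_normD _ _))// mulr2n mulrDl mul1r !normrM lerD//.
- by rewrite (le_trans _ hA)// ler_piMr// cos_max.
- by rewrite (le_trans _ hB)// ler_piMr// sin_max.
Qed.

Section decay.
Variable w : R.
Hypothesis w0 : 0 < w.
Hypothesis decay : forall t, `|t| <= pi -> re t ^+ 2 + im t ^+ 2 <= gauss 0 w t ^+ 2.

(** Extended by zero, the integrands for all [n > 0] live on the whole line under the single
    integrable bound [2 * gauss 0 w u]. *)
Definition trunc_kernel n y : R -> R :=
  kernel n (Num.sqrt n%:R) y \_ `[- (pi * Num.sqrt n%:R), pi * Num.sqrt n%:R].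

Lemma measurable_trunc_kernel n y : measurable_fun [set: R] (trunc_kernel n y).
Proof.
apply/(measurable_restrictT _ _).1 => //.
by apply: (measurable_funS measurableT) => //; exact: measurable_kernel.
Qed.

Lemma trunc_kernel_le n y u : (0 < n)%N -> `|trunc_kernel n y u| <= 2 * gauss 0 w u.
Proof.
move=> n0; rewrite /trunc_kernel patchE; case: ifPn => [|_]; last first.
  by rewrite normr0 mulr_ge0 ?gauss_ge0.
by rewrite inE/= in_itv/= -ler_norml => us; exact: kernel_gauss_le.
Qed.

Lemma walk_trunc_kernel n k : (0 < n)%N ->
  Num.sqrt n%:R * walk P K n k =
  (2 * pi)^-1 * \int[mu]_u trunc_kernel n (k%:~R - n%:R * m) u.
Proof.
move=> n0; have s0 : 0 < Num.sqrt n%:R :> R by rewrite sqrtr_gt0 ltr0n.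
rewrite -Rintegral_mkcond -walk_fourier//.
have pi0 : pi != 0 :> R by rewrite gt_eqF// pi_gt0.
set W := walk _ _ _ _; set S := Num.sqrt _.
have -> : 2 * pi * S * W = (2 * pi) * (S * W) by ring.
by rewrite mulKf// mulf_neq0.
Qed.

Lemma walk_le_decay : exists2 M : R, 0 < M &
  forall n k, (0 < n)%N -> Num.sqrt n%:R * walk P K n k <= M.
Proof.
have ig := integrable_EFinZl 2 (integrable_gauss 0 w0).
have pi0 : 0 < (2 * pi)^-1 :> R by rewrite invr_gt0 mulr_gt0// pi_gt0.
exists ((2 * pi)^-1 * (\int[mu]_u (2 * gauss 0 w u) + 1)).
  by rewrite mulr_gt0// ltr_wpDl// Rintegral_ge0// => u _; rewrite mulr_ge0 ?gauss_ge0.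
move=> n k n0; rewrite walk_trunc_kernel// ler_wpM2l ?(ltW pi0)//.
rewrite ler_wpDr//; apply: le_Rintegral => //.
  apply: le_integrable_EFin ig; first exact: measurable_trunc_kernel.
  by move=> u; exact: trunc_kernel_le.
by move=> u _; rewrite (le_trans (ler_norm _))// trunc_kernel_le.
Qed.

(** The index is shifted by one so that the scale never vanishes. *)
Notation sq n := (Num.sqrt (n.+1%:R : R)).

Let sq0 n : 0 < sq n. Proof. by rewrite sqrtr_gt0 ltr0n. Qed.

Let sqsq n : sq n ^+ 2 = n.+1%:R. Proof. by rewrite sqr_sqrtr. Qed.

Lemma cvg_inv_sqrt : (sq n)^-1 @[n --> \oo] --> 0.
Proof.
rewrite -[X in _ --> X](sqrtr0 R).
under eq_fun do rewrite -sqrtrV//.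
by apply: (cvg_comp _ _ (@cvg_harmonic R)); exact: sqrt_continuous.
Qed.

Lemma near_sqrt_ge a : \forall n \near \oo, a <= sq n.
Proof.
near=> n; rewrite (le_trans (ler_norm _))// -sqrtr_sqr ler_wsqrtr//.
rewrite (@le_trans _ _ n%:R) ?ler_nat//.
by near: n; exact: nbhs_infty_ger.
Unshelve. all: by end_near. Qed.

Lemma cvg_rate (f : nat -> R) l a : (forall n, `|f n - l| <= a / sq n) ->
  f n @[n --> \oo] --> l.
Proof.
move=> fl; apply/subr_cvg0; apply: norm_cvg0.
have h : a / sq n @[n --> \oo] --> a * 0 by apply: cvgMr; exact: cvg_inv_sqrt.
rewrite mulr0 in h.
by apply: (squeeze_cvgr _ (cvg_cst 0) h); apply: nearW => n; rewrite normr_ge0/=.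
Qed.

Let iY2u u : P.-integrable setT (EFin \o (fun x => u ^+ 2 * Y x ^+ 2)).
Proof. by apply: integrable_EFinZl; exact: (integrable_sqr mK hK). Qed.

Let mz u n : measurable_fun setT (fun x => u / sq n * Y x).
Proof. by mfun. Qed.

Let zsq u n x : n.+1%:R * (u / sq n * Y x) ^+ 2 = u ^+ 2 * Y x ^+ 2.
Proof.
have e := sqsq n; have := sq0 n; set s := Num.sqrt _ in e *; rewrite -e => s0.
by field; rewrite gt_eqF.
Qed.

(** The step is centred, so [sin z] may be replaced by [sin z - z]. Multiplied by [n.+1], this is
    dominated by [u ^+ 2 * Y ^+ 2] and is pointwise of order [1 / sq n]. *)
Lemma cvg_imcf u : n.+1%:R * im (u / sq n) @[n --> \oo] --> 0.
Proof.
have E n : n.+1%:R * im (u / sq n) =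
    \int[P]_x (n.+1%:R * (sin (u / sq n * Y x) - u / sq n * Y x)).
  have i1 : P.-integrable setT (EFin \o (fun x => sin (u / sq n * Y x))).
    by apply: (integrable_bounded P (c := 1)); [mfun|move=> x; exact: sin_max].
  have i2 : P.-integrable setT (EFin \o (fun x => u / sq n * Y x)).
    by apply: integrable_EFinZl; exact: (integrable_centered mK hK).
  rewrite RintegralZl//; last exact: integrable_EFinB.
  rewrite RintegralB// RintegralZl//; last exact: (integrable_centered mK hK).
  by rewrite (Rintegral_centered mK hK) mulr0 subr0.
have h : \int[P]_x (n.+1%:R * (sin (u / sq n * Y x) - u / sq n * Y x)) @[n --> \oo] -->
    \int[P]_x (cst (0 : R) x).
  apply: (@Rdominated_cvg _ _ R P (fun n x => n.+1%:R * (sin (u / sq n * Y x) - u / sq n * Y x))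
    (cst 0) _ _ _ (iY2u u)).
  - by move=> n; mfun.
  - move=> x; apply: (@cvg_rate _ _ (`|u * Y x| ^+ 3 / 2)) => n.
    rewrite subr0 normrM ger0_norm//.
    rewrite (le_trans (ler_wpM2l _ (norm_sinB_le3 _)))//.
    have e := sqsq n; have := sq0 n; set s := Num.sqrt _ in e *; rewrite -e => s0.
    rewrite !normrM normfV (gtr0_norm s0).
    by rewrite le_eqVlt; apply/orP; left; apply/eqP; field; rewrite gt_eqF.
  - move=> n x; rewrite normrM ger0_norm// -(zsq u n x).
    by rewrite ler_wpM2l// norm_sinB_le2.
rewrite Rintegral_cst// mul0r in h.
by rewrite (eq_cvg _ _ E).
Qed.

Lemma cvg_recf u : n.+1%:R * (re (u / sq n) - 1) @[n --> \oo] --> - (v * u ^+ 2 / 2).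
Proof.
have E n : n.+1%:R * (re (u / sq n) - 1) = \int[P]_x (n.+1%:R * (cos (u / sq n * Y x) - cst 1 x)).
  have i1 : P.-integrable setT (EFin \o (fun x => cos (u / sq n * Y x))).
    by apply: (integrable_bounded P (c := 1)); [mfun|move=> x; exact: cos_max].
  have i2 : P.-integrable setT (EFin \o (cst (1 : R))).
    exact: finite_measure_integrable_cst.
  rewrite RintegralZl//; last exact: integrable_EFinB.
  by rewrite RintegralB// Rintegral_cst//= mul1r probability_setT.
have h : \int[P]_x (n.+1%:R * (cos (u / sq n * Y x) - cst 1 x)) @[n --> \oo] -->
    \int[P]_x (- (u ^+ 2 / 2) * Y x ^+ 2).
  apply: (@Rdominated_cvg _ _ R P (fun n x => n.+1%:R * (cos (u / sq n * Y x) - cst 1 x))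
    (fun x => - (u ^+ 2 / 2) * Y x ^+ 2) _ _ _ (iY2u u)).
  - by move=> n; mfun.
  - move=> x; apply: (@cvg_rate _ _ ((u * Y x) ^+ 4 / 2)) => n; set z := u / sq n * Y x.
    rewrite (_ : _ - _ = n.+1%:R * (cos z - 1 + z ^+ 2 / 2)); last first.
      have zz : n.+1%:R * z ^+ 2 = u ^+ 2 * Y x ^+ 2 := zsq u n x.
      have -> : n.+1%:R * (cos z - 1 + z ^+ 2 / 2) = n.+1%:R * (cos z - 1) + n.+1%:R * z ^+ 2 / 2.
        by field.
      by rewrite zz /cst; field.
    rewrite normrM ger0_norm// (le_trans (ler_wpM2l _ (norm_cosB_le4 _)))//.
    (* The error is of order [1 / n.+1]; one factor [1 / sq n] is given away to fit [cvg_rate]. *)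
    rewrite (_ : n.+1%:R * (z ^+ 4 / 2) = (u * Y x) ^+ 4 / 2 / sq n / sq n); last first.
      rewrite /z; have e := sqsq n; have := sq0 n; set s := Num.sqrt _ in e *; rewrite -e => s0.
      by field; rewrite gt_eqF.
    rewrite ler_piMr//; first by rewrite divr_ge0 ?(ltW (sq0 n))// divr_ge0// exprn_even_ge0.
    by rewrite invf_le1// -[leLHS]sqrtr1 ler_wsqrtr// ler1n.
  - move=> n x; rewrite normrM ger0_norm// /cst distrC ger0_norm ?onem_cos_ge0//.
    rewrite -(zsq u n x) ler_wpM2l// (le_trans (onem_cos_le _))// ler_piMr ?sqr_ge0//.
    by rewrite invf_le1// ler1n.
have hv : \int[P]_x (- (u ^+ 2 / 2) * Y x ^+ 2) = - (v * u ^+ 2 / 2).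
  rewrite RintegralZl//; last exact: (integrable_sqr mK hK).
  by rewrite (Rintegral_sqr hK); field.
by rewrite hv in h; rewrite (eq_cvg _ _ E).
Qed.

(** With [x = c / n.+1], the exponential lies between [1 - x] and [1 / (1 + x)], and the latter is
    at most [1 - x + x^2] since [(1 - x + x^2) (1 + x) = 1 + x^3]. *)
Lemma cvg_gauss_root (c : R) : 0 <= c -> n.+1%:R * (expR (- (c / n.+1%:R)) - 1) @[n --> \oo] --> - c.
Proof.
move=> c0; apply: (@cvg_rate _ _ (c ^+ 2)) => n; set N := n.+1%:R.
have N0 : 0 < N by rewrite ltr0n.
have cN : 0 <= c / N by rewrite divr_ge0// ltW.
have lo : - c <= N * (expR (- (c / N)) - 1).
  rewrite -ler_pdivrMl// mulrC mulNr lerBrDl; exact: expR_ge1Dx.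
have up : N * (expR (- (c / N)) - 1) <= - c + c ^+ 2 / N.
  rewrite -ler_pdivlMl// expRN lerBlDl.
  have h1 : 1 + c / N <= expR (c / N) := expR_ge1Dx _.
  have h2 : 0 < 1 + c / N by rewrite ltr_wpDr.
  rewrite (le_trans (_ : _ <= (1 + c / N)^-1))//; first by rewrite lef_pV2 ?posrE ?expR_gt0.
  rewrite -[leLHS]mul1r ler_pdivrMr//.
  have -> : (1 + N^-1 * (- c + c ^+ 2 / N)) * (1 + c / N) = 1 + (c / N) ^+ 3.
    by field; rewrite gt_eqF.
  by rewrite lerDl exprn_ge0.
have le : c ^+ 2 / N <= c ^+ 2 / Num.sqrt N.
  rewrite ler_wpM2l ?sqr_ge0// lef_pV2 ?posrE ?sq0// /N -[leRHS]sqsq expr2.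
  by rewrite ler_peMl ?(ltW (sq0 n))// -[leLHS]sqrtr1 ler_wsqrtr// ler1n.
rewrite opprK ger0_norm; last by rewrite -lerBlDr sub0r.
by rewrite -lerBrDr (le_trans up)// addrC lerD2r.
Qed.

(** The central limit theorem on the Fourier side. The real number [W n] has the Gaussian as its
    exact power of order [n.+1], and it agrees with [phi (u / sq n)] up to an error that vanishes
    even after multiplication by [n.+1], as [cpow_approx] requires. *)
Lemma cvg_cpow u : 0 < v ->
  (cpow (re (u / sq n)) (im (u / sq n)) n.+1).1 @[n --> \oo] --> gauss 0 v^-1 u /\
  (cpow (re (u / sq n)) (im (u / sq n)) n.+1).2 @[n --> \oo] --> 0.
Proof.
move=> v0.
have cf1 n : re (u / sq n) ^+ 2 + im (u / sq n) ^+ 2 <= 1 := cf_norm_le1 P mK m (u / sq n).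
pose c := v * u ^+ 2 / 2.
have c0 : 0 <= c by rewrite divr_ge0// mulr_ge0 ?sqr_ge0// ltW.
pose W n := expR (- (c / n.+1%:R)).
have W1 n : `|W n| <= 1.
  by rewrite ger0_norm ?expR_ge0// -expR0 ler_expR oppr_le0 divr_ge0.
have WN n : W n ^+ n.+1 = gauss 0 v^-1 u.
  rewrite /W /gauss -expRM_natl; congr expR.
  by rewrite subr0 /c; field; rewrite gt_eqF//= gt_eqF// ltr0n.
have approx n := cpow_approx n.+1 (cf1 n) (W1 n).
have him : n.+1%:R * `|im (u / sq n)| @[n --> \oo] --> 0.
  have h : `|n.+1%:R * im (u / sq n)| @[n --> \oo] --> `|0 : R|.
    by apply: cvg_norm; exact: cvg_imcf.
  have e n : n.+1%:R * `|im (u / sq n)| = `|n.+1%:R * im (u / sq n)|.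
    by rewrite normrM ger0_norm.
  by rewrite normr0 in h; rewrite (eq_cvg _ _ e).
have hre : n.+1%:R * `|re (u / sq n) - W n| @[n --> \oo] --> 0.
  have h : `|n.+1%:R * (re (u / sq n) - 1) - n.+1%:R * (W n - 1)| @[n --> \oo] -->
      `|- (v * u ^+ 2 / 2) - - c|.
    by apply: cvg_norm; apply: cvgB; [exact: cvg_recf|exact: cvg_gauss_root].
  have e n : n.+1%:R * `|re (u / sq n) - W n| =
      `|n.+1%:R * (re (u / sq n) - 1) - n.+1%:R * (W n - 1)|.
    by rewrite -mulrBr normrM ger0_norm//; congr (_ * `|_|); ring.
  by rewrite subrr normr0 in h; rewrite (eq_cvg _ _ e).
split.
- apply/subr_cvg0; apply: norm_cvg0.
  have h : n.+1%:R * `|re (u / sq n) - W n| + n.+1%:R * `|im (u / sq n)| @[n --> \oo] --> 0 + (0 : R).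
    exact: cvgD.
  rewrite addr0 in h.
  apply: (squeeze_cvgr _ (cvg_cst 0) h); apply: nearW => n.
  by rewrite normr_ge0/= -(WN n) -mulrDr; have [] := approx n.
- apply: norm_cvg0; apply: (squeeze_cvgr _ (cvg_cst 0) him); apply: nearW => n.
  by rewrite normr_ge0/=; have [] := approx n.
Qed.

Lemma walk_local_limit x : 0 < v ->
  sq n * walk P K n.+1 (Num.floor (x * sq n + n.+1%:R * m)) @[n --> \oo] -->
    (Num.sqrt (2 * pi * v))^-1 * gauss 0 v x.
Proof.
move=> v0; have vn0 : v != 0 by rewrite gt_eqF.
(* The centred lattice point just below [x * sq n]; rounding costs less than one unit, which the
   scale [sq n] absorbs. *)
pose y n := (Num.floor (x * sq n + n.+1%:R * m))%:~R - n.+1%:R * m.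
have yx n : `|y n / sq n - x| <= 1 / sq n.
  have /andP[h1 h2] := floor_itv (x * sq n + n.+1%:R * m).
  rewrite intrD in h2.
  have -> : y n / sq n - x = (y n - x * sq n) / sq n by field; rewrite gt_eqF.
  rewrite normrM normfV (gtr0_norm (sq0 n)) ler_wpM2r ?invr_ge0 ?(ltW (sq0 n))//.
  by rewrite ler_norml /y; apply/andP; split; lra.
have ycvg : y n / sq n @[n --> \oo] --> x by exact: cvg_rate yx.
have lim : \int[mu]_u trunc_kernel n.+1 (y n) u @[n --> \oo] -->
    \int[mu]_u (cos (u * x) * gauss 0 v^-1 u).
  apply: (@Rdominated_cvg _ _ R mu _ _ (fun u => 2 * gauss 0 w u)).
  - by move=> n; exact: measurable_trunc_kernel.
  - move=> u; have [hA hB] := cvg_cpow u v0.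
    have hy : u * (y n / sq n) @[n --> \oo] --> u * x by exact: cvgMr.
    have h : kernel n.+1 (sq n) (y n) u @[n --> \oo] -->
        gauss 0 v^-1 u * cos (u * x) + 0 * sin (u * x).
      have e n : u / sq n * y n = u * (y n / sq n) by rewrite mulrAC -mulrA.
      under eq_fun do rewrite /kernel e.
      apply: cvgD; apply: cvgM => //.
      - by apply: (cvg_comp _ _ hy); exact: continuous_cos.
      - by apply: (cvg_comp _ _ hy); exact: continuous_sin.
    rewrite mul0r addr0 mulrC in h.
    (* At a fixed [u] the truncation is eventually inactive. *)
    apply: cvg_trans h; apply: near_eq_cvg; near=> n.
    rewrite /trunc_kernel patchE mem_set//= in_itv/= -ler_norml -ler_pdivrMl ?pi_gt0//.
    by near: n; exact: near_sqrt_ge.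
  - exact: integrable_EFinZl (integrable_gauss 0 w0).
  - by move=> n u; exact: trunc_kernel_le.
rewrite fourier_gauss ?invr_gt0// invrK in lim.
have h : (2 * pi)^-1 * \int[mu]_u trunc_kernel n.+1 (y n) u @[n --> \oo] -->
    (2 * pi)^-1 * (Num.sqrt (2 * pi / v) * gauss 0 v x) by exact: cvgMr.
have e n : sq n * walk P K n.+1 (Num.floor (x * sq n + n.+1%:R * m)) =
    (2 * pi)^-1 * \int[mu]_u trunc_kernel n.+1 (y n) u by rewrite walk_trunc_kernel.
have pi0 : 0 < 2 * pi :> R by rewrite mulr_gt0// pi_gt0.
have ab : Num.sqrt (2 * pi * v) * Num.sqrt (2 * pi / v) = 2 * pi.
  rewrite -sqrtrM; last by rewrite mulr_ge0 ?(ltW pi0) ?(ltW v0).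
  rewrite (_ : 2 * pi * v * (2 * pi / v) = (2 * pi) ^+ 2); last by field.
  by rewrite sqrtr_sqr gtr0_norm.
have E2 : (2 * pi)^-1 * Num.sqrt (2 * pi / v) = (Num.sqrt (2 * pi * v))^-1.
  apply: (@mulfI _ (Num.sqrt (2 * pi * v))); first by rewrite gt_eqF// sqrtr_gt0 mulr_gt0.
  by rewrite mulrCA ab mulVf ?mulfV// gt_eqF// sqrtr_gt0 mulr_gt0.
by rewrite mulrA E2 in h; rewrite (eq_cvg _ _ e).
Unshelve. all: by end_near. Qed.

End decay.

End local_limit.

(** * The entropy limit of the walk *)

Section walk_entropy_limit.
Context d (T : measurableType d) (R : realType) (P : probability T R) (K : T -> int).
Hypothesis mK : forall k, measurable (K @^-1` [set k]).
Variables (m v : R).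
Hypothesis hK : forall c : R,
  (\int[P]_x (((K x)%:~R - m + c) ^+ 2)%:E = (v + c ^+ 2)%:E)%E.
Hypothesis aper : aperiodic P K.
Notation mu := (@lebesgue_measure R).
Notation sq n := (Num.sqrt (n.+1%:R : R)).

Let v0 : 0 < v := aperiodic_var_gt0 mK hK aper.

(** The differential entropy of the Gaussian density of variance [v]. *)
Let L : R := ln (Num.sqrt (2 * pi * v)) + 2^-1.

Let pi0 : 0 < 2 * pi :> R. Proof. by rewrite mulr_gt0// pi_gt0. Qed.

Let Z0 : 0 < Num.sqrt (2 * pi * v). Proof. by rewrite sqrtr_gt0 mulr_gt0. Qed.

Lemma integral_gauss_entropy M :
  (\int[mu]_x ((Num.sqrt (2 * pi * v))^-1 * gauss 0 v x *
     (M - ln ((Num.sqrt (2 * pi * v))^-1 * gauss 0 v x)))%:E = (M + L)%:E)%E.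
Proof.
set Z := Num.sqrt _.
have Zn0 : Z != 0 by rewrite gt_eqF.
have i1 := integrable_EFinZl (Z^-1 * (M + ln Z)) (integrable_gauss 0 v0).
have i2 := integrable_EFinZl (Z^-1 / (2 * v)) (integrable_sqr_gauss v0).
have E x : Z^-1 * gauss 0 v x * (M - ln (Z^-1 * gauss 0 v x)) =
    Z^-1 * (M + ln Z) * gauss 0 v x + Z^-1 / (2 * v) * (x ^+ 2 * gauss 0 v x).
  rewrite lnM ?posrE ?gauss_gt0 ?invr_gt0// lnV ?posrE//.
  have -> : ln (gauss 0 v x) = - (x ^+ 2 / (2 * v)) by rewrite /gauss expRK subr0.
  by field; rewrite Zn0 gt_eqF.
under eq_integral do rewrite E EFinD.
rewrite integralD//.
rewrite -[LHS]fineK; last by rewrite fin_numD !integrable_fin_num.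
rewrite fineD ?integrable_fin_num//; congr (_%:E).
rewrite -/(Rintegral mu setT (fun x => Z^-1 * (M + ln Z) * gauss 0 v x)).
rewrite -/(Rintegral mu setT (fun x => Z^-1 / (2 * v) * (x ^+ 2 * gauss 0 v x))).
rewrite !RintegralZl//; [|exact: integrable_sqr_gauss|exact: integrable_gauss].
rewrite integral_sqr_gauss// [X in _ * X + _]/Rintegral integral_gauss//= -/Z /L.
by field; rewrite Zn0 gt_eqF.
Qed.

Lemma walk_entropy_ge0 n : (0 <= walk_entropy P K n)%E.
Proof.
apply: esum_ge0 => k _; rewrite lee_fin -mulrN mulr_ge0 ?walk_ge0// oppr_ge0 ln_le0//.
exact: walk_le1.
Qed.

Lemma sq_ge1 n : 1 <= sq n.
Proof. by rewrite -[leLHS]sqrtr1 ler_wsqrtr// ler1n. Qed.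

Lemma walk_entropy_lower (e : R) : 0 < e ->
  \forall n \near \oo, ((L - e + ln (sq n))%:E <= walk_entropy P K n.+1)%E.
Proof.
move=> e0; have [w w0 decay] := cf_decay mK m aper.
have [M1 M10 hM1] := walk_le_decay mK w0 decay.
(* Enlarged so that [ln M >= 0], which allows [ln M] to be written as a sum of nonnegative terms
   below. *)
pose M := M1 + 1; have M0 : 0 < M by rewrite addr_gt0.
have M_ge1 : 1 <= M by rewrite lerDr ltW.
have hM n k : sq n * walk P K n.+1 k <= M by rewrite (le_trans (hM1 _ _ _))// lerDl.
pose g (t : R) := t * (ln M - ln t).
have g0 t : 0 <= t <= M -> 0 <= g t.
  move=> /andP[]; rewrite le_eqVlt => /orP[/eqP <-|t0 tM]; first by rewrite /g mul0r.
  by rewrite /g mulr_ge0 ?(ltW t0)// subr_ge0 ler_ln ?posrE.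
have swM n k : 0 <= sq n * walk P K n.+1 k <= M.
  by rewrite hM mulr_ge0 ?walk_ge0.
pose G n k := g (sq n * walk P K n.+1 k).
pose f_ n (x : R) := G n (Num.floor (x * sq n + n.+1%:R * m)).
have sqn0 n : 0 < sq n by rewrite (lt_le_trans _ (sq_ge1 n)).
have f0 n x : 0 <= f_ n x by exact: g0.
have mf n : measurable_fun [set: R] (f_ n).
  apply: (@measurable_fun_int _ _ (fun x : R => Num.floor (x * sq n + n.+1%:R * m)) _ _ _ (G n)).
  by move=> k; exact: measurable_floor_preimage.
pose phi x := (Num.sqrt (2 * pi * v))^-1 * gauss 0 v x.
have phi0 x : 0 < phi x by rewrite mulr_gt0 ?gauss_gt0// invr_gt0.
have ff x : f_ n x @[n --> \oo] --> g (phi x).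
  have h := walk_local_limit mK hK w0 decay (x := x) v0.
  apply: cvgM => //; apply: cvgB; first exact: cvg_cst.
  by apply: (cvg_comp _ _ h); apply: continuous_ln; exact: phi0.
have := @fatou_real _ _ R mu f_ (fun x => g (phi x)) (ln M + L) e mf f0 ff
  (integral_gauss_entropy (ln M)) e0.
apply: filterS => n hn.
(* The integral is the sum of [p (ln M - ln (sq n) - ln p)]. Both constants are spread over the
   walk, whose mass is [1]; nothing is subtracted, since finiteness of the entropy is not yet known
   here. *)
have fE : (\int[mu]_x (f_ n x)%:E + (ln (sq n))%:E = (ln M)%:E + walk_entropy P K n.+1)%E.
  rewrite (@integral_floor _ (sq n) (n.+1%:R * m) (fun k => (G n k)%:E))//; last first.
    by move=> k; rewrite lee_fin g0.
  have lnM0 : 0 <= ln M by rewrite ln_ge0.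
  have lns0 : 0 <= ln (sq n) by rewrite ln_ge0// sq_ge1.
  have c1 (c : R) : 0 <= c -> (c%:E = \esum_(k in [set: int]) (c * walk P K n.+1 k)%:E)%E.
    by move=> c0; rewrite esum_intZl ?esum_walk ?mule1// => k; exact: walk_ge0.
  rewrite (c1 _ lns0) (c1 _ lnM0) /walk_entropy -!esumD.
  - apply: eq_esum => k _; rewrite -EFinM -!EFinD; congr (_%:E).
    have := walk_ge0 P mK n.+1 k; rewrite le_eqVlt => /orP[/eqP p0|p0].
      by rewrite /G /g -p0 !(mulr0, mul0r) oppr0 !addr0.
    rewrite /G /g lnM ?posrE//; have := sqn0 n; set p := walk _ _ _ _ in p0 *; set q := Num.sqrt _ => q0.
    by field; rewrite gt_eqF.
  - by move=> k _; rewrite lee_fin mulr_ge0 ?walk_ge0.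
  - move=> k _; rewrite lee_fin -mulrN mulr_ge0 ?walk_ge0// oppr_ge0 ln_le0//.
    exact: walk_le1.
  - by move=> k _; rewrite mule_ge0 ?lee_fin ?g0// invr_ge0 ltW.
  - by move=> k _; rewrite lee_fin mulr_ge0 ?walk_ge0.
have := leeD hn (lexx (ln (sq n))%:E); rewrite fE -EFinD.
rewrite (_ : ln M + L - e + ln (sq n) = ln M + (L - e + ln (sq n))); last by ring.
by rewrite EFinD leeD2lE.
Qed.

(** The logarithm of the normalising bound splits into [ln (sq n)], the constant of [L], and the
    discretisation loss [(8 * (n.+1%:R * v))^-1], which is eventually below [e]. *)
Lemma walk_entropy_upper (e : R) : 0 < e ->
  \forall n \near \oo, (walk_entropy P K n.+1 <= (L + e + ln (sq n))%:E)%E.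
Proof.
move=> e0; near=> n.
have sqn0 : 0 < sq n by rewrite (lt_le_trans _ (sq_ge1 n)).
have nv0 : 0 < n.+1%:R * v by rewrite mulr_gt0// ltr0n.
have ne0 : 0 < 8 * (n.+1%:R * v) by rewrite mulr_gt0.
have srE : Num.sqrt (2 * pi * (n.+1%:R * v)) = sq n * Num.sqrt (2 * pi * v).
  by rewrite -sqrtrM//; congr Num.sqrt; ring.
apply: (le_trans (walk_entropy_le mK hK nv0 _)).
  rewrite srE -[leLHS]mulr1 ler_pM//.
    by rewrite -[leLHS]expR0 ler_expR invr_ge0 ltW.
  rewrite -ler_pdivrMr//; near: n; exact: near_sqrt_ge.
rewrite lee_fin srE lnM ?posrE ?expR_gt0 ?mulr_gt0// expRK lnM ?posrE// /L.
have : (8 * (n.+1%:R * v))^-1 <= e.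
  rewrite invf_ple ?posrE// mulrCA -ler_pdivrMr ?mulr_gt0//.
  rewrite (@le_trans _ _ n%:R) ?ler_nat//; near: n; exact: nbhs_infty_ger.
set q := (8 * _)^-1; set a := ln (Num.sqrt _); set b := ln (Num.sqrt _); lra.
Unshelve. all: by end_near. Qed.

Lemma walk_entropy_cvg :
  (walk_entropy P K n.+1 - (ln (sq n))%:E)%E @[n --> \oo] --> L%:E.
Proof.
have fin : \forall n \near \oo, walk_entropy P K n.+1 \is a fin_num.
  near=> n; rewrite ge0_fin_numE ?walk_entropy_ge0//.
  have h : (walk_entropy P K n.+1 <= (L + 1 + ln (sq n))%:E)%E.
    by near: n; exact: walk_entropy_upper.
  by rewrite (le_lt_trans h)// ltry.
apply: cvg_EFin.
  by near=> n; rewrite fin_numB andbT; near: n.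
apply/cvgrPdist_le => e e0; near=> n.
have hf : walk_entropy P K n.+1 \is a fin_num by near: n.
have hl : ((L - e + ln (sq n))%:E <= walk_entropy P K n.+1)%E.
  by near: n; exact: walk_entropy_lower.
have hu : (walk_entropy P K n.+1 <= (L + e + ln (sq n))%:E)%E.
  by near: n; exact: walk_entropy_upper.
rewrite /comp fineB//=; move: hl hu; rewrite -(fineK hf) !lee_fin/= => hl hu.
by rewrite ler_norml; apply/andP; split; lra.
Unshelve. all: by end_near. Qed.

End walk_entropy_limit.

(** * Reduction to the walk *)

(* The complement of the support is covered by countably many null rational intervals. *)
Lemma law_support_conull d (T : measurableType d) (R : realType) (P : probability T R)
    (Y : {RV P >-> R}) (B : set R) : measurable B -> law_support Y `<=` B ->
  P (Y @^-1` (~` B)) = 0%E.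
Proof.
move=> mB YB; change (distribution P Y (~` B) = 0%E).
pose J (pq : (rat * rat)%type) : set R := `]ratr pq.1, ratr pq.2[%classic.
pose N (n : nat) : set R := if choice.unpickle n is Some pq then
  if `[< distribution P Y (J pq) = 0%E >] then J pq else set0 else set0.
have N0 n : (distribution P Y).-negligible (N n).
  rewrite /N; case: choice.unpickle => [pq|]; last exact: negligible_set0.
  case: asboolP => [h|_]; last exact: negligible_set0.
  by apply/negligibleP => //; exact: measurable_itv.
apply: measure_negligible; first exact: measurableC.
apply: negligibleS (negligible_bigcup N0) => y nBy.
have /existsNP[U /not_implyP[oU /not_implyP[Uy /negP]]] : ~ law_support Y y by move/YB.
rewrite -leNgt => PU.
have [e /= e0 eU] : exists2 e : R, 0 < e & ball y e `<=` U.
  by have /nbhs_ballP := open_nbhs_nbhs (conj oU Uy).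
have [p] := @rat_in_itvoo R (y - e) y ltac:(by rewrite ltrBlDr ltrDl).
have [q] := @rat_in_itvoo R y (y + e) ltac:(by rewrite ltrDl).
rewrite !in_itv/= => /andP[yq qe] /andP[pe py].
have pqU : J (p, q) `<=` U.
  move=> z; rewrite /J/= in_itv/= => /andP[pz zq]; apply: eU; rewrite /ball/=.
  by rewrite ltr_distl; apply/andP; split; lra.
have J0 : distribution P Y (J (p, q)) = 0%E.
  apply/eqP; rewrite eq_le measure_ge0 andbT; apply: le_trans PU.
  apply: le_measure pqU; rewrite inE; first exact: measurable_itv.
  exact: open_measurable.
exists (choice.pickle (p, q)); first exact: Logic.I.
rewrite /N choice.pickleK asboolT; last exact: J0.
by rewrite /J /= in_itv/= py yq.
Qed.

Section lattice.
Context d (T : measurableType d) (R : realType) (P : probability T R).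
Variable X : nat -> {RV P >-> R}.
Hypothesis Xiid : iid X.
Variables (a h : R).
Hypothesis h0 : 0 < h.
Hypothesis Xlat : law_support (X 0%N) `<=` [set y | exists k : int, y = a + k%:~R * h].

Definition lattice_points (b : R) : set R := [set y | exists k : int, y = b + k%:~R * h].

Lemma measurable_lattice_points b : measurable (lattice_points b).
Proof.
rewrite (_ : lattice_points b = \bigcup_n [set b + (int_of_nat n)%:~R * h]).
  by apply: bigcupT_measurable => n; exact: measurable_set1.
apply/seteqP; split => y /=.
  by move=> [k ->]; exists (nat_of_int k) => //=; rewrite nat_of_intK.
by move=> [n _ ->]; exists (int_of_nat n).
Qed.

Lemma off_lattice0 i : P (X i @^-1` (~` lattice_points a)) = 0%E.
Proof.
have mC : measurable (~` lattice_points a) by apply: measurableC; exact: measurable_lattice_points.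
rewrite -(law_support_conull (measurable_lattice_points a) Xlat).
exact: (Xiid.2 i 0%N _ mC).
Qed.

(* Meaningful only where [X i] takes its value in the lattice. *)
Definition lattice_index i (x : T) : int := Num.floor ((X i x - a) / h).

Lemma lattice_indexK i x : lattice_points a (X i x) ->
  X i x = a + (lattice_index i x)%:~R * h.
Proof.
move=> [k E]; rewrite /lattice_index E addrAC subrr add0r mulfK ?gt_eqF//.
by rewrite floorK ?intr_int.
Qed.

Lemma lattice_index_eq i x k : X i x = a + k%:~R * h -> lattice_index i x = k.
Proof.
by move=> E; rewrite /lattice_index E addrAC subrr add0r mulfK ?gt_eqF// intrKfloor.
Qed.

Lemma measurable_lattice_index i k : measurable (lattice_index i @^-1` [set k]).
Proof.
rewrite (_ : _ @^-1` _ = X i @^-1` ((fun y => Num.floor (y * h^-1 + - (a / h))) @^-1` [set k])).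
  rewrite -[X in measurable X]setTI; apply: measurable_funPT => //.
  by apply: measurable_floor_preimage; rewrite invr_gt0.
by apply/seteqP; split => x /=; rewrite /lattice_index mulrBl.
Qed.

(** The two events differ only where [X i] is off the lattice: there the floor still returns an
    integer, but the event is null. *)
Lemma measure_lattice_index (A : set T) i k : measurable A ->
  P (A `&` lattice_index i @^-1` [set k]) = P (A `&` X i @^-1` [set a + k%:~R * h]).
Proof.
move=> mA.
have mX1 : measurable (X i @^-1` [set a + k%:~R * h]).
  by rewrite -[X in measurable X]setTI; apply: measurable_funPT => //; exact: measurable_set1.
have mO : measurable (X i @^-1` (~` lattice_points a)).
  rewrite -[X in measurable X]setTI; apply: measurable_funPT => //.
  by apply: measurableC; exact: measurable_lattice_points.
have mK := measurable_lattice_index i k.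
apply/eqP; rewrite eq_le; apply/andP; split.
- rewrite -[leRHS](@measureU0 _ _ _ P _ (X i @^-1` (~` lattice_points a)))//; last exact: off_lattice0.
  apply: le_measure; rewrite ?inE; [exact: measurableI|by apply: measurableU => //; exact: measurableI|].
  move=> x [Ax /= Kx]; have [l|nl] := pselect (lattice_points a (X i x)); last by right.
  by left; split => //=; rewrite (lattice_indexK l) Kx.
- apply: le_measure; rewrite ?inE; [exact: measurableI|exact: measurableI|].
  by move=> x [Ax /= Ex]; split => //=; exact: lattice_index_eq.
Qed.

Lemma partial_sumS n : partial_sum X n.+1 = partial_sum X n \+ X n :> (T -> R).
Proof. by rewrite /partial_sum big_ord_recr. Qed.

Lemma measurable_preimage (Y : {RV P >-> R}) (B : set R) : measurable B -> measurable (Y @^-1` B).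
Proof. by move=> mB; rewrite -[X in measurable X]setTI; apply: measurable_funPT. Qed.

Notation K := (lattice_index 0%N).

(* The event on the later [X i] makes the induction go through: each step moves one more
   variable into it, by mutual independence. *)
Lemma partial_sum_walk n k (J : {fset nat}) (B : nat -> set R) :
  (forall i, i \in J -> (n <= i)%N) -> (forall i, i \in J -> measurable (B i)) ->
  P (partial_sum X n @^-1` [set n%:R * a + k%:~R * h] `&` \bigcap_(i in [set` J]) X i @^-1` B i) =
  ((walk P K n k)%:E * P (\bigcap_(i in [set` J]) X i @^-1` B i))%E.
Proof.
elim: n k J B => [|n IH] k J B Jn mB.
  have -> : partial_sum X 0 @^-1` [set 0%:R * a + k%:~R * h] = if k == 0 then setT else set0.
    apply/seteqP; split => x /=; rewrite /partial_sum big_ord0 mul0r add0r.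
      move/esym/eqP; rewrite mulf_eq0 (gt_eqF h0) orbF intr_eq0 => /eqP ->.
      by rewrite eqxx.
    by case: eqP => // -> _; rewrite mul0r.
  rewrite /=; case: eqP => _; first by rewrite setTI mul1e.
  by rewrite set0I measure0 mul0e.
set Q := \bigcap_(i in [set` J]) X i @^-1` B i.
have mQ : measurable Q.
  by apply: fin_bigcap_measurable => // i Ji; apply: measurable_preimage; exact: mB.
set A := partial_sum X n.+1 @^-1` _.
have mA : measurable A by apply: measurable_preimage; exact: measurable_set1.
(* Split on the index [j] of [X n]: the first [n] variables must then reach [k - j], and [X n] joins
   the later variables through [B']. *)
rewrite (measure_int_partition P (measurable_lattice_index n)); last exact: measurableI.
have nJ : n \notin J by apply/negP => /Jn; rewrite ltnn.
have E j : P (A `&` Q `&` lattice_index n @^-1` [set j]) =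
    ((walk P K n (k - j))%:E * P (K @^-1` [set j]) * P Q)%E.
  rewrite measure_lattice_index; last exact: measurableI.
  pose B' i := if i == n then [set a + j%:~R * h] else B i.
  have B'E : \bigcap_(i in [set` (n |` J)%fset]) X i @^-1` B' i =
      X n @^-1` [set a + j%:~R * h] `&` Q.
    rewrite bigcap_fsetU1 /B' eqxx; congr (_ `&` _); apply: eq_bigcapr => i /= Ji.
    by rewrite ifF//; apply/negbTE/eqP => ni; rewrite -ni Ji in nJ.
  have J'n i : i \in (n |` J)%fset -> (n <= i)%N.
    by rewrite !inE => /orP[/eqP ->//|/Jn/ltnW].
  have mB' i : i \in (n |` J)%fset -> measurable (B' i).
    rewrite !inE /B'; case: eqP => [_ _|_ /= Ji]; first exact: measurable_set1.
    exact: mB.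
  have := IH (k - j) _ _ J'n mB'; rewrite B'E => IH'.
  transitivity (P (partial_sum X n @^-1` [set n%:R * a + (k - j)%:~R * h] `&`
      (X n @^-1` [set a + j%:~R * h] `&` Q))).
    congr (P _); apply/seteqP; split => x /=; rewrite /A/= partial_sumS/=.
      move=> [[S Qx] Xx]; split => //; rewrite Xx in S; rewrite intrB.
      by move/(canRL (addrK _)): S => ->; rewrite -[n.+1]addn1 natrD; ring.
    move=> [S [Xx Qx]]; split => //; split => //; rewrite S Xx intrB.
    by rewrite -[n.+1]addn1 natrD; ring.
  rewrite IH' -muleA; congr (_ * _)%E.
  rewrite -B'E (Xiid.1 _ _ mB') big_fsetU1//= /B' eqxx /Q (Xiid.1 _ _ mB).
  congr (_ * _)%E; last first.
    by apply: eq_fbigr => i Ji _; rewrite ifF//; apply/negbTE/eqP => ni; rewrite -ni Ji in nJ.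
  (* The walk is built from the index of the first variable alone, so the law of [X n] is exchanged
     for that of [X 0]. *)
  transitivity (distribution P (X 0%N) [set a + j%:~R * h]).
    exact: (Xiid.2 n 0%N _ (measurable_set1 _)).
  have := measure_lattice_index 0%N j (@measurableT _ T).
  by rewrite !setTI => ->.
rewrite (eq_esum (fun j _ => E j)).
have PQ : P Q = (fine (P Q))%:E by rewrite fineK// fin_num_measure.
have pK j : P (K @^-1` [set j]) = (fine (P (K @^-1` [set j])))%:E.
  by rewrite fineK// fin_num_measure//; exact: measurable_lattice_index.
have mK := measurable_lattice_index 0%N.
rewrite (walkS P mK) (integral_comp_int P mK (F := fun j => (walk P K n (k - j))%:E)); last first.
  by move=> j; rewrite lee_fin walk_ge0.
rewrite muleC PQ -[in RHS](eq_esum (a := fun j => (walk P K n (k - j) * fine (P (K @^-1` [set j])))%:E)).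
  rewrite -esum_intZl ?fine_ge0//; last by move=> j; rewrite mulr_ge0 ?walk_ge0 ?fine_ge0.
  by apply: eq_esum => j _; rewrite pK -!EFinM; congr (_%:E); rewrite mulrC.
by move=> j _; rewrite EFinM -(pK j).
Qed.

Lemma partial_sum_pmf n k : pmf (partial_sum X n) (n%:R * a + k%:~R * h) = walk P K n k.
Proof.
have mB0 : forall i, i \in fset0 -> measurable ((fun _ : nat => [set: R]) i) by [].
have := @partial_sum_walk n k fset0 (fun=> setT) (fun _ => ltac:(by [])) mB0.
by rewrite set_fset0 bigcap_set0 setIT probability_setT mule1 /pmf => ->.
Qed.

Lemma partial_sum_off_lattice n :
  P (partial_sum X n @^-1` (~` lattice_points (n%:R * a))) = 0%E.
Proof.
apply: measure_negligible.
  by apply: measurable_preimage; apply: measurableC; exact: measurable_lattice_points.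
elim: n => [|n IH].
  rewrite (_ : _ @^-1` _ = set0); first exact: negligible_set0.
  apply/seteqP; split => // x /=; apply.
  by rewrite /partial_sum big_ord0; exists 0; rewrite mul0r add0r mul0r.
have Xn : P.-negligible (X n @^-1` (~` lattice_points a)).
  apply/negligibleP; last exact: off_lattice0.
  by apply: measurable_preimage; apply: measurableC; exact: measurable_lattice_points.
apply: negligibleS (negligibleU IH Xn) => x /=; rewrite partial_sumS/= => nl.
apply/not_andP => -[[j Ej] [l El]]; apply: nl; exists (j + l).
by rewrite Ej El intrD -[n.+1]addn1 natrD; ring.
Qed.

(** Both sums are compared with the one over the whole shifted lattice: lattice points of mass zero
    contribute [0], and no atom lies off the lattice. *)
Lemma entropy_partial_sum n : entropy (partial_sum X n) = walk_entropy P K n.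
Proof.
pose e (k : int) : R := n%:R * a + k%:~R * h.
have einj : set_inj [set: int] e.
  move=> j k _ _ /addrI /(mulIf (lt0r_neq0 h0)) /eqP; rewrite eqr_int => /eqP //.
pose F y := (- (pmf (partial_sum X n) y * ln (pmf (partial_sum X n) y)))%:E.
have pmf1 y : pmf (partial_sum X n) y <= 1.
  rewrite /pmf -lee_fin fineK; last first.
    by rewrite fin_num_measure//; apply: measurable_preimage; exact: measurable_set1.
  by apply: probability_le1; apply: measurable_preimage; exact: measurable_set1.
have F0 y : (0 <= F y)%E.
  by rewrite lee_fin -mulrN mulr_ge0 ?pmf_ge0// oppr_ge0 ln_le0.
transitivity (\esum_(y in e @` setT) F y).
  rewrite (esumID [set y | 0 < pmf (partial_sum X n) y] (e @` setT))//.
  rewrite [X in (_ = _ + X)%E]esum1 ?adde0; last first.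
    move=> y [_ /= /negP]; rewrite -leNgt => p0.
    have p00 : pmf (partial_sum X n) y = 0 by apply/eqP; rewrite eq_le p0 pmf_ge0.
    by rewrite /F p00 mul0r oppr0.
  rewrite setIidr// => y /= py; apply/not_notP => nEy.
  have : P (partial_sum X n @^-1` [set y]) = 0%E.
    apply: subset_measure0 (partial_sum_off_lattice n).
    - by apply: measurable_preimage; exact: measurable_set1.
    - by apply: measurable_preimage; apply: measurableC; exact: measurable_lattice_points.
    - by move=> x /= -> [k Ek]; apply: nEy; exists k.
  by move=> P0; rewrite /pmf P0 ltxx in py.
rewrite esum_image// /walk_entropy; apply: eq_esum => k _.
by rewrite /F /e partial_sum_pmf.
Qed.

End lattice.

(* A finite variance forces [Y] to be integrable, so that [fine] does not hide an infinite
   expectation. *)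
Lemma integral_sqr_affine d (T : measurableType d) (R : realType) (P : probability T R)
    (Y : {RV P >-> R}) (s b c : R) : 'V_P[Y] = s%:E ->
  (\int[P]_x ((b * (Y x - fine 'E_P[Y]) + c) ^+ 2)%:E = (b ^+ 2 * s + c ^+ 2)%:E)%E.
Proof.
rewrite /variance covariance.unlock expectation.unlock => EV.
set m := fine _ in EV *.
pose Z x := Y x - m.
have mY : measurable_fun setT Y by exact: measurable_funPT.
have mZ : measurable_fun setT Z by rewrite /Z; mfun.
have mZ2 : measurable_fun setT (fun x => Z x ^+ 2) by mfun.
have EZ2 : (\int[P]_x (Z x ^+ 2)%:E = s%:E)%E by rewrite -EV; apply: eq_integral.
have iZ2 : P.-integrable setT (EFin \o (fun x => Z x ^+ 2)).
  apply/integrableP; split; first exact/measurable_EFinP.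
  under eq_integral do rewrite /= ger0_norm ?sqr_ge0//.
  by rewrite EZ2 ltry.
have i1 (r : R) : P.-integrable setT (EFin \o (fun _ : T => r)).
  by apply: finite_measure_integrable_cst.
have Ec (r : R) : (\int[P]_x r%:E = r%:E)%E.
  by have := expectation_cst P r; rewrite expectation.unlock.
have iZ : P.-integrable setT (EFin \o Z).
  apply: (le_integrable_EFin (g := fun x => 1 + Z x ^+ 2)) => //; last exact: integrable_EFinD.
  by move=> x; rewrite -real_normK ?num_real//; move: (`|Z x|) => t; nra.
have iY : P.-integrable setT (EFin \o Y).
  rewrite (_ : EFin \o Y = EFin \o (fun x => Z x + m)); first exact: integrable_EFinD.
  by apply/funext => x; rewrite /= /Z subrK.
have EZ : (\int[P]_x (Z x)%:E = 0)%E.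
  rewrite /Z; under eq_integral do rewrite EFinB.
  rewrite integralB//=; last exact: (i1 m).
  rewrite Ec.
  by rewrite /m fineK ?subee//; exact: integrable_fin_num.
transitivity (\int[P]_x ((b ^+ 2 * Z x ^+ 2)%:E + (2 * b * c * Z x + c ^+ 2)%:E))%E.
  by apply: eq_integral => x _; rewrite -EFinD /Z; congr (_%:E); ring.
rewrite integralD//; last 2 first.
  exact: (integrable_EFinZl _ iZ2).
  by apply: (integrable_EFinD (f := fun x => 2 * b * c * Z x) (g := fun=> c ^+ 2)) => //; exact: integrable_EFinZl.
under eq_integral do rewrite EFinM.
rewrite integralZl// EZ2.
under [X in (_ + X)%E]eq_integral do rewrite EFinD.
rewrite integralD//; [|exact: (integrable_EFinZl _ iZ)|exact: i1].
under [X in (_ + (X + _))%E]eq_integral do rewrite EFinM.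
by rewrite integralZl// EZ mule0 add0e Ec EFinD EFinM.
Qed.

Section lattice_law.
Context d (T : measurableType d) (R : realType) (P : probability T R).
Variable X : nat -> {RV P >-> R}.
Hypothesis Xiid : iid X.
Variables (a h : R).
Hypothesis h0 : 0 < h.
Hypothesis Xlat : law_support (X 0%N) `<=` [set y | exists k : int, y = a + k%:~R * h].
Notation K := (lattice_index X a h 0%N).

Let mK := measurable_lattice_index X a h0 0%N.
Let mX := @measurable_preimage _ _ _ P.

(** This supplies the moment hypothesis [hK] of the earlier sections, with variance [s / h ^+ 2].
    The integrands agree only almost everywhere, because the index is meaningless off the
    lattice. *)
Lemma integral_sqr_lattice_index s c : 'V_P[X 0%N] = s%:E ->
  (\int[P]_x (((K x)%:~R - (fine 'E_P[X 0%N] - a) / h + c) ^+ 2)%:E =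
   (s / h ^+ 2 + c ^+ 2)%:E)%E.
Proof.
move=> V; set m := fine _.
transitivity (\int[P]_x ((h^-1 * (X 0%N x - m) + c) ^+ 2)%:E)%E; last first.
  by rewrite (integral_sqr_affine _ _ V) exprVn mulrC.
apply: ge0_ae_eq_integral => //.
- exact: (measurable_fun_int mK (fun k : int => ((k%:~R - (m - a) / h + c) ^+ 2)%:E)).
- by apply/measurable_EFinP; have mX0 : measurable_fun setT (X 0%N) by []; mfun.
- by move=> x _; rewrite lee_fin sqr_ge0.
- by move=> x _; rewrite lee_fin sqr_ge0.
exists (X 0%N @^-1` (~` lattice_points h a)); split.
- by apply: mX; apply: measurableC; exact: measurable_lattice_points.
- exact: off_lattice0.
move=> x /= /not_implyP[_ nE] l; apply: nE; congr ((_ ^+ 2)%:E).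
by rewrite [in RHS](lattice_indexK h0 l); field; rewrite gt_eqF.
Qed.

(* The ball of radius [h] meets the lattice only at its centre. *)
Lemma atom_of_support (k : int) : law_support (X 0%N) (a + k%:~R * h) ->
  (0 < P (K @^-1` [set k]))%E.
Proof.
move=> Sk; have := Sk (ball (a + k%:~R * h) h) (ball_open _ _) (ballxx _ h0).
rewrite -(setTI (_ @^-1` _)) measure_lattice_index// setTI => /lt_le_trans; apply.
rewrite -[leRHS](@measureU0 _ _ _ P _ (X 0%N @^-1` (~` lattice_points h a))); last 3 first.
- by apply: mX; exact: measurable_set1.
- by apply: mX; apply: measurableC; exact: measurable_lattice_points.
- exact: off_lattice0.
rewrite /distribution /pushforward; apply: le_measure; rewrite ?inE.
- by apply: mX; apply: open_measurable; exact: ball_open.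
- apply: measurableU; first by apply: mX; exact: measurable_set1.
  by apply: mX; apply: measurableC; exact: measurable_lattice_points.
move=> x /= Bx; have [[j Ej]|nl] := pselect (lattice_points h a (X 0%N x)); last by right.
left; move: Bx; rewrite /ball/= Ej opprD addrACA subrr add0r -mulrBl normrM (gtr0_norm h0).
rewrite -[X in _ < X]mul1r ltr_pM2r// -intrB -intr_norm -[X in _ < X]/(1%:~R) ltr_int.
by rewrite -abszE ltz_nat ltnS leqn0 absz_eq0 subr_eq0 => /eqP ->.
Qed.

(** If [n > 0] divides all differences of atoms, the support lies in a lattice of span [n h], and
    maximality forces [n <= 1]. *)
Lemma maximal_span_aperiodic : maximal_span (X 0%N) h -> aperiodic P K.
Proof.
move=> [_ hmax].
have [j0 Pj0] : exists j0, (0 < P (K @^-1` [set j0]))%E.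
  apply: contrapT => /forallNP PK0.
  have := probability_setT P; rewrite (measure_int_partition P mK measurableT) esum1.
    by move/eqP; rewrite eq_sym onee_eq0.
  move=> k _; rewrite setTI; apply/eqP; rewrite eq_le measure_ge0 andbT.
  by rewrite leNgt; apply/negP; exact: PK0.
exists j0 => // n nK.
(* For [n = 0] there is a single atom, which fits a lattice of any span; [2] is enough to contradict
   maximality. *)
pose e : nat := if n == 0%N then 2%N else n.
have e0 : (0 < e)%N by rewrite /e; case: eqP => // /eqP; rewrite lt0n.
have : lattice_span (X 0%N) (e%:R * h).
  split; first by rewrite mulr_gt0 ?ltr0n.
  exists (a + j0%:~R * h) => y Sy; have [k Ek] := Xlat Sy.
  rewrite Ek in Sy; have := nK k (atom_of_support Sy).
  move=> nkj.
  have /dvdzP[q Eq] : (e%:Z %| k - j0)%Z.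
    rewrite /e; case: eqP nkj => // -> /dvdzP[q ->]; by rewrite mulr0 dvdz0.
  exists q; rewrite Ek /= -addrA; congr (_ + _).
  by rewrite mulrA -[e%:R]/(e%:Z%:~R) -intrM -Eq intrB -mulrDl addrC subrK.
move/hmax; rewrite -[leRHS]mul1r ler_pM2r// -[1]/(1%:R) ler_nat /e.
by case: eqP => // /eqP; rewrite -lt0n => n0 n1; apply/eqP; rewrite eqn_leq n1.
Qed.

End lattice_law.

Theorem theorem1p1 (d : measure_display) (T : measurableType d) (R : realType)
    (P : probability T R) (X : nat -> {RV P >-> R}) (sigma h : R)
    (Xiid : iid X)
    (Xvar : 'V_P[X 0%N] = (sigma ^+ 2)%:E)
    (Xspan : maximal_span (X 0%N) h) :
  (entropy (partial_sum X n) - (ln (Num.sqrt n%:R / h))%:E)%E @[n --> \oo]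
    --> (2^-1 * ln (2 * pi * expR 1 * sigma ^+ 2))%:E.
Proof.
have [[h0 [a Xlat]] _] := Xspan.
have mK := measurable_lattice_index X a h0 0%N.
have hK c := integral_sqr_lattice_index Xiid h0 Xlat c Xvar.
have aper := maximal_span_aperiodic Xiid h0 Xlat Xspan.
have v0 := aperiodic_var_gt0 mK hK aper.
have s0 : 0 < sigma ^+ 2 by move: v0; rewrite pmulr_lgt0// invr_gt0 exprn_gt0.
have ln_sqrt (r : R) : 0 < r -> ln (Num.sqrt r) = 2^-1 * ln r.
  by move=> r0; rewrite -powR12_sqrt ?ltW// ln_powR.
have pi0 := pi_gt0 R.
move: (sigma ^+ 2) s0 hK {v0 Xvar} => w w0 hK.
(* The walk has variance [w / h ^+ 2], so its limit misses the target by [ln h], which is exactly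
   the part split off from [ln (sqrt n / h)]. *)
have -> : 2^-1 * ln (2 * pi * expR 1 * w) = ln (Num.sqrt (2 * pi * (w / h ^+ 2))) + 2^-1 + ln h.
  have p0 : 0 < 2 * pi :> R by rewrite mulr_gt0.
  have hh0 : 0 < h ^+ 2 by rewrite exprn_gt0.
  rewrite ln_sqrt ?mulr_gt0 ?invr_gt0//.
  rewrite !(lnM, ln_div) ?posrE ?divr_gt0 ?mulr_gt0 ?expR_gt0 ?invr_gt0//.
  by rewrite expRK lnV ?posrE// lnXn//; field.
rewrite EFinD -cvg_shiftS.
apply: cvg_trans (cvgeD _ (walk_entropy_cvg mK hK aper) (cvg_cst (ln h)%:E)) => //.
apply: near_eq_cvg; apply: nearW => n.
rewrite /= (entropy_partial_sum Xiid h0 Xlat) ln_div ?posrE ?sqrtr_gt0//.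
by rewrite -addeA -EFinD; congr (_ + _%:E)%E; ring.
Qed.
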